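(* Let $K$ be a field and let $F=F_1\cup\cdots\cup F_k$ be a fat tree with $F_i$ a simplex of dimension $d_i$ and $(F_1\cup\cdots\cup F_{j-1})\cap F_j$ a simplex of dimension $r_j$. Then: (1) The Hilbert series of the Stanley-Reisner ring $K[F]$ is $$\sum_{i=1}^k\frac{1}{(1-t)^{d_i+1}}-\sum_{i=2}^{k}\frac{1}{(1-t)^{r_i+1}}.$$ (2) The projective dimension of $K[F]$ is $$\sum_{i=1}^k d_i-\sum_{i=2}^k r_i+1-\min\{r_i\}-2.$$ (3) The depth of $K[F]$ is $\min\{r_i\}+2$. (4) $F$ is CM (that is, $K[F]$ is Cohen-Macaulay) if and only if there is a $d$ such that $d_i=d$ for all $i$ and $r_i=d-1$ for all $i$.
   Context: A simplex of dimension $d$ has $d+1$ vertices. Fat forests are defined recursively: a simplex $F_1$ of dimension $\ge 0$ is a fat forest; if $F_1,\dots,F_k$ are simplices and $G_{k-1}=F_1\cup\cdots\cup F_{k-1}$ is a fat forest, then $G_{k-1}\cup F_k$ is a fat forest if $G_{k-1}\cap F_k$ is a simplex of dimension $\ge -1$ (dimension $-1$ meaning that $G_{k-1}$ and $F_k$ are disjoint). A fat forest is called a fat tree if it is connected, i.e. if $\dim(G_{j-1}\cap F_j)\ge 0$ at every step $j$. The numbers $r_j$ are indexed by $j=2,\dots,k$. For a simplicial complex $\Delta$ on $\{1,\dots,n\}$, the Stanley-Reisner ring is $K[\Delta]=S/I$ with $S=K[x_1,\dots,x_n]$, where $I$ is generated by the squarefree monomials $x_{i_1}\cdots x_{i_m}$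 for which $\{i_1,\dots,i_m\}$ does not belong to $\Delta$. Here $n$ is the number of vertices, and projective dimension is taken over $S$. The Hilbert series of a graded $K$-algebra $R$ is $\sum_{j\ge0}\dim_K(R_j)t^j$.
   Formalization: Parts (2), (3) and (4) are stated under the extra assumption that no F_i is contained in another F_j (the F_i are the facets of F), without which they fail, e.g. for F_1 = F_2; parts (2) and (3) also assume k ≥ 2, since min{r_i} is otherwise over an empty set. *)

(* Defs.v *)
From HB Require Import structures.
From mathcomp Require Import all_boot all_order all_algebra.
From mathcomp Require Import ring_quotient boolp mpoly.

Set Implicit Arguments.
Unset Strict Implicit.
Unset Printing Implicit Defensive.

Import Order.TTheory GRing.Theory Num.Theory.

Local Open Scope ring_scope.
Local Open Scope quotient_scope.

Record simplicial_complex (n : nat) := SimplicialComplex {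
  faces :> {set {set 'I_n}};
  face0 : set0 \in faces;
  face1 : forall i : 'I_n, [set i] \in faces;
  face_sub : forall A B : {set 'I_n}, B \in faces -> A \subset B -> A \in faces
}.

(* A simplex is the set of all subsets of its vertex set A; its dimension is
   #|A| - 1, so that the complex {set0} is the simplex of dimension -1. *)
Definition simplex_of_dim n (D : {set {set 'I_n}}) (e : int) : Prop :=
  exists2 A : {set 'I_n}, D = powerset A & e = #|A|%:Z - 1.

Section FatForests.
Variables (n k : nat) (F : 'I_k -> {set {set 'I_n}}).

(* The family F_1, ..., F_k is indexed from 0: before F j is the union of the
   simplices that strictly precede F j. *)
Definition before (j : 'I_k) : {set {set 'I_n}} := \bigcup_(i < k | (i < j)%N) F i.

Definition fat_forest : Prop :=
  [/\ (0 < k)%N,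
      forall i, exists e, simplex_of_dim (F i) e,
      forall i : 'I_k, i = 0%N :> nat -> exists2 e, simplex_of_dim (F i) e & 0 <= e
    & forall j : 'I_k, (0 < j)%N -> exists e, simplex_of_dim (before j :&: F j) e].

Definition fat_tree : Prop :=
  fat_forest /\
  forall j : 'I_k, (0 < j)%N ->
    exists2 e, simplex_of_dim (before j :&: F j) e & 0 <= e.

(* The F i are the facets of their union: none of them lies in another one. *)
Definition irredundant : Prop := forall i j, F i \subset F j -> i = j.

End FatForests.

(* The minimum of r over the nonzero indices, for k >= 2 (the inner maximum is
   only there to provide a neutral value). *)
Definition min_tail k (r : 'I_k -> nat) : nat :=
  \big[minn/(\max_(i < k | (0 < i)%N) r i)%N]_(i < k | (0 < i)%N) r i.

Lemma min_tailP k (r : 'I_k -> nat) : (1 < k)%N ->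
  (exists2 i : 'I_k, (0 < i)%N & min_tail r = r i) /\
  (forall i : 'I_k, (0 < i)%N -> (min_tail r <= r i)%N).
Proof.
move=> k1; pose i1 := Ordinal k1; rewrite /min_tail; set M := (\max_(i < k | _) _)%N.
have [i0 i0_gt0 M_E] : exists2 i : 'I_k, (0 < i)%N & M = r i.
  have : (0 < #|[pred i : 'I_k | (0 < i)%N]|)%N by apply/card_gt0P; exists i1.
  by move/(eq_bigmax_cond r) => [i Pi Mi]; exists i.
split.
  apply: (big_ind (fun m => exists2 i : 'I_k, (0 < i)%N & m = r i)).
  - by exists i0.
  - by move=> x y [i Pi ->] [j Pj ->]; rewrite /minn; case: ifP => _; [exists i|exists j].
  - by move=> i Pi; exists i.
move=> i Pi; elim: (index_enum _) (mem_index_enum i) => // a s IHs.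
rewrite inE big_cons => /orP[/eqP<-|/IHs le]; first by rewrite Pi geq_minl.
by case: ifP => _ //; apply: leq_trans (geq_minr _ _) le.
Qed.

(* The inverse of p in Z[[t]] when p`_0 = 1: 1/p = sum_m (1 - p)^m, where only
   the terms with m <= j contribute to the coefficient of t^j. *)
Definition fps_inv (p : {poly int}) (j : nat) : int :=
  (\sum_(m < j.+1) (1 - p) ^+ m)`_j.

Lemma fps_invP (p : {poly int}) : p`_0 = 1 ->
  forall j, \sum_(i < j.+1) p`_i * fps_inv p (j - i) = (j == 0%N)%:R.
Proof.
move=> p0 j; pose q := 1 - p.
have q0 : q`_0 = 0 by rewrite coefB coef1 p0 subrr.
have qlow m i : (i < m)%N -> (q ^+ m)`_i = 0.
  elim: m i => // m IHm i; rewrite ltnS exprS => lim; rewrite coefM big1 // => a _.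
  case: (posnP (a : nat)) => [->|a0]; first by rewrite q0 mul0r.
  by rewrite IHm ?mulr0 //; case: (i) a a0 lim => [[]//[]//|i' a a0 lim];
     rewrite (leq_trans _ lim) // ltnS; case: (nat_of_ord a) a0 => // a' _;
     rewrite subSS leq_subr.
have invE a : (a <= j)%N -> fps_inv p a = (\sum_(m < j.+1) q ^+ m)`_a.
  move=> aj; rewrite /fps_inv !coef_sum -/q.
  rewrite -!(big_mkord predT (fun m => (q ^+ m)`_a)) [RHS](big_cat_nat _ (n := a.+1)) //=.
  by rewrite [X in _ + X]big_nat_cond [X in _ + X]big1 ?addr0 // => m /andP[/andP[am _] _]; apply: qlow.
transitivity ((p * \sum_(m < j.+1) q ^+ m)`_j).
  by rewrite coefM; apply: eq_bigr => i _; rewrite invE ?leq_subr.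
have -> : p * \sum_(m < j.+1) q ^+ m = 1 - q ^+ j.+1.
  by rewrite -opprB subrX1 -mulNr opprB opprB addrC subrK.
by rewrite coefB qlow // subr0 coef1.
Qed.

Definition inv_one_minus_t_pow (m : nat) : nat -> int := fps_inv ((1 - 'X) ^+ m).

Section CommutativeAlgebra.
Variable R : comNzRingType.

Definition in_ideal (s : seq R) (x : R) : Prop :=
  exists c : 'I_(size s) -> R, x = \sum_(i < size s) c i * s`_i.

Definition regular_sequence (s : seq R) : Prop :=
  ~ in_ideal s 1 /\
  forall i, (i < size s)%N ->
    forall x, in_ideal (take i s) (s`_i * x) -> in_ideal (take i s) x.

Definition is_depth (J : R -> Prop) (e : nat) : Prop :=
  (exists s : seq R,
     [/\ size s = e, (forall x, x \in s -> J x) & regular_sequence s]) /\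
  (forall s : seq R,
     (forall x, x \in s -> J x) -> regular_sequence s -> (size s <= e)%N).

(* prime_idealr bundles boolean predicates; with classical logic (`[< _ >])
   this covers all prime ideals. The chain is P 0 < ... < P e, and the values
   of P beyond e are irrelevant. *)
Definition prime_chain (e : nat) : Prop :=
  exists P : nat -> prime_idealr R, forall i, (i < e)%N ->
    {subset P i <= P i.+1} /\ exists2 x, x \in P i.+1 & x \notin P i.

Definition is_krull_dim (e : nat) : Prop :=
  prime_chain e /\ forall e', prime_chain e' -> (e' <= e)%N.

End CommutativeAlgebra.

Section ProjectiveDimension.
Variable R : nzRingType.

Definition surjective (A B : Type) (f : A -> B) : Prop := forall b, exists a, f a = b.

Definition projective (P : lmodType R) : Prop :=
  forall (A B : lmodType R) (g : {linear A -> B}) (f : {linear P -> B}),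
    surjective g -> exists h : {linear P -> A}, forall x, g (h x) = f x.

(* An exact sequence 0 -> P_p -> ... -> P_1 -> P_0 -> M -> 0 with every P_i
   projective. *)
Definition projective_resolution_of_length (M : lmodType R) (p : nat) : Prop :=
  exists (P : nat -> lmodType R) (d : forall i, {linear P i.+1 -> P i})
         (eps : {linear P 0%N -> M}),
    [/\ forall i, projective (P i),
        surjective eps,
        forall x, eps x = 0 <-> exists y, d 0%N y = x,
        forall i x, d i x = 0 <-> exists y, d i.+1 y = x
      & forall i, (p < i)%N -> forall x : P i, x = 0].

Definition is_projdim (M : lmodType R) (p : nat) : Prop :=
  projective_resolution_of_length M p /\
  forall q, projective_resolution_of_length M q -> (p <= q)%N.

End ProjectiveDimension.

Section StanleyReisner.
Variables (K : fieldType) (n : nat) (D : simplicial_complex n).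

Local Notation S := {mpoly K[n]}.

Definition SR_ideal : {pred S} := fun p =>
  `[< exists c : {set 'I_n} -> S,
        p = \sum_(A : {set 'I_n} | A \notin faces D) c A * \prod_(i in A) 'X_i >].

Lemma SR_ideal_closed : idealr_closed SR_ideal.
Proof.
split.
- by apply/asboolP; exists (fun=> 0); rewrite big1 // => A _; rewrite mul0r.
- apply/asboolP => -[c /(congr1 (fun p : S => p.@[fun=> 0]))].
  rewrite meval1 rmorph_sum big1 /= => [/eqP|A nDA]; first by rewrite oner_eq0.
  have [A0|[i iA]] := set_0Vmem A; first by rewrite A0 face0 in nDA.
  by rewrite mevalM rmorph_prod (bigD1 i) //= mevalXU mul0r mulr0.
- move=> a p q /asboolP[cp ->] /asboolP[cq ->]; apply/asboolP.
  exists (fun A => a * cp A + cq A); rewrite mulr_sumr -big_split /=.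
  by apply: eq_bigr => A _; rewrite mulrDl mulrA.
Qed.

HB.instance Definition _ := isIdealr.Build S SR_ideal SR_ideal_closed.

Definition SR_ring : Type := {ideal_quot SR_ideal}.

HB.instance Definition _ := GRing.ComNzRing.on SR_ring.

Definition SR_proj (p : S) : SR_ring := \pi_{ideal_quot SR_ideal} p.

Lemma SR_projD : {morph SR_proj : p q / p + q}.
Proof. by move=> p q; rewrite /SR_proj rmorphD. Qed.

Lemma SR_projM : {morph SR_proj : p q / p * q}.
Proof. by move=> p q; rewrite /SR_proj rmorphM. Qed.

Lemma SR_proj1 : SR_proj 1 = 1.
Proof. by rewrite /SR_proj rmorph1. Qed.

Definition SR_scale (p : S) (x : SR_ring) : SR_ring := SR_proj p * x.

Fact SR_scaleA p q x : SR_scale p (SR_scale q x) = SR_scale (p * q) x.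
Proof. by rewrite /SR_scale SR_projM mulrA. Qed.

Fact SR_scale1 : left_id 1 SR_scale.
Proof. by move=> x; rewrite /SR_scale SR_proj1 mul1r. Qed.

Fact SR_scaleDr : right_distributive SR_scale +%R.
Proof. by move=> p x y; rewrite /SR_scale mulrDr. Qed.

Fact SR_scaleDl x : {morph SR_scale^~ x : p q / p + q}.
Proof. by move=> p q; rewrite /SR_scale SR_projD mulrDl. Qed.

HB.instance Definition _ := GRing.Zmodule_isLmodule.Build S SR_ring
  SR_scaleA SR_scale1 SR_scaleDr SR_scaleDl.

Definition SR_component (j : nat) (x : SR_ring) : Prop :=
  exists2 p : S, p \is j.-homog & x = SR_proj p.

(* The elements of K act on SR_ring as constant polynomials. *)
Definition has_Kdim (V : SR_ring -> Prop) (h : nat) : Prop :=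
  exists b : 'I_h -> SR_ring,
    [/\ forall i, V (b i),
        forall x, V x -> exists c : 'I_h -> K, x = \sum_(i < h) (c i)%:MP *: b i
      & forall c : 'I_h -> K,
          \sum_(i < h) (c i)%:MP *: b i = 0 -> forall i, c i = 0].

Definition is_Hilbert_series (H : nat -> int) : Prop :=
  forall j, exists2 h : nat, has_Kdim (SR_component j) h & H j = h%:Z.

Definition SR_irrelevant : SR_ring -> Prop :=
  in_ideal [seq SR_proj 'X_i | i <- enum 'I_n].

Definition SR_projdim (p : nat) : Prop := is_projdim SR_ring p.

Definition SR_depth (e : nat) : Prop := is_depth SR_irrelevant e.

(* Depth is taken at the irrelevant ideal, as is customary for graded
   algebras. *)
Definition SR_CohenMacaulay : Prop :=
  exists2 e, is_krull_dim SR_ring e & SR_depth e.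

End StanleyReisner.

(* Main.v *)
(* Write S = K[x_1, ..., x_n], let A_i and s_j be the vertex sets of F_i and of
   (F_1 u ... u F_{j-1}) n F_j, and for a complex D let I(D) be its
   Stanley-Reisner ideal, so that I(D u D') = I(D) n I(D') and
   I(D n D') = I(D) + I(D'). Put e = min r_j + 2.

   Depth and projective dimension are bounded on one side by induction along the
   tree, with the sequences 0 -> S/(I n J) -> S/I x S/J -> S/(I + J) -> 0. The
   first e elementary symmetric polynomials restrict to regular sequences on the
   polynomial rings of the F_i (which have at least e variables), and the first
   e - 1 of them on those of the simplices s_j, so they form a regular sequence
   on K[F]; in the same way the projective dimension is at most n - e.

   For the other side, removing from F the vertices of an s_j of minimal size
   disconnects it, which gives a nonzero class in the Koszul homology
   H_{n-e}(x; K[F]). A regular sequence of length l in (x) turns it into a nonzero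
   class of degree n - e + l, so l <= e, and a projective resolution of length p
   forces H_i(x; K[F]) = 0 for i > p, so p >= n - e.

   Prime ideals of K[F] are compared with those of the rings K[F_i]: chains have
   length at most max d_i + 1 because m + 1 polynomials in m variables are
   algebraically dependent. The Hilbert series and the number of vertices follow
   by inclusion-exclusion along the tree. *)

Require Import Defs.
From HB Require Import structures.
From mathcomp Require Import all_boot all_order all_algebra.
From mathcomp Require Import ring_quotient boolp freeg mpoly.
From mathcomp Require Import ring zify.

Set Implicit Arguments.
Unset Strict Implicit.
Unset Printing Implicit Defensive.

Import Order.TTheory GRing.Theory Num.Theory.

Local Open Scope ring_scope.

(** * Submodules and projective dimension *)

(** All the work takes place in S itself: ideals are submodules of [S^o], regularity and Koszul
    cycles are stated modulo an ideal, and projective dimension is bounded for the ideal, where it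
    is one less than for the quotient. The quotient ring enters only in the final transfer.

    The regular sequence has to be the same on all simplices at once, and K may be finite, so that
    general linear forms can be lacking. Elementary symmetric polynomials serve over every field;
    the price is a graded argument that exchanges them with variables.

    Long exact sequences are replaced by explicit constructions on one syzygy or one cycle. In e =
    min r_j + 2, a simplex s_j contributes its r_j + 1 variables, and passing from S/(I + J) to S/(I
    n J) gains one more.

    Irredundancy acts twice: it gives r_j < d_j, so that the F_i themselves never lower the bound,
    and it leaves vertices on both sides once s_j is removed. *)

Section Submodules.
Variables (R : nzRingType) (V : lmodType R).

(** The predicate is valued in [Prop], so that ideals can be given by conditions on coefficients or
    by existential formulas. It becomes boolean only in [submod_mem], to form the subtype. *)
Record submod := Submod {
  submod_pred :> V -> Prop;
  submod0 : submod_pred 0;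
  submodL : forall a u v, submod_pred u -> submod_pred v ->
    submod_pred (a *: u + v)
}.

(** Equality rather than equivalence lets ideals be rewritten under [wregular] and [pdle]. *)
Lemma submod_ext (U W : submod) : (forall x, U x <-> W x) -> U = W.
Proof.
case: U W => [U U0 UL] [W W0 WL] /= UW.
have E : U = W by apply: funext => x; apply/propext.
by case: W / E W0 WL UW => W0 WL _; congr Submod; apply: Prop_irrelevance.
Qed.

Lemma submodD (U : submod) u v : U u -> U v -> U (u + v).
Proof. by move=> uU vU; rewrite -[u]scale1r; apply: submodL. Qed.

Lemma submodZ (U : submod) a u : U u -> U (a *: u).
Proof. by move=> uU; rewrite -[_ *: _]addr0; apply: submodL => //; apply: submod0. Qed.

Lemma submodN (U : submod) u : U u -> U (- u).
Proof. by rewrite -scaleN1r; apply: submodZ. Qed.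

Lemma submodB (U : submod) u v : U u -> U v -> U (u - v).
Proof. by move=> uU vU; apply: submodD => //; apply: submodN. Qed.

Lemma submod_sum (U : submod) (I : Type) (r : seq I) (P : pred I) (f : I -> V) :
  (forall i, P i -> U (f i)) -> U (\sum_(i <- r | P i) f i).
Proof. by move=> Uf; apply: big_ind => //; [apply: submod0 | apply: submodD]. Qed.

Variable U : submod.

Definition submod_mem : {pred V} := fun x => `[< U x >].

Fact submod_mem_closed : submod_closed submod_mem.
Proof.
split; first exact/asboolP/submod0.
by move=> a u v /asboolP uU /asboolP vU; apply/asboolP/submodL.
Qed.

HB.instance Definition _ :=
  GRing.isSubmodClosed.Build R V submod_mem (GRing.submod_closed_semi submod_mem_closed).

Record submod_type := SubmodType { submod_val :> V; _ : submod_val \in submod_mem }.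

HB.instance Definition _ := [isSub for submod_val].
HB.instance Definition _ := [Choice of submod_type by <:].
HB.instance Definition _ := [SubChoice_isSubLmodule of submod_type by <:].

Lemma submod_valP (u : submod_type) : U (submod_val u).
Proof. by case: u => u /= /asboolP. Qed.

Definition to_submod (x : V) (Ux : U x) : submod_type :=
  @SubmodType x (asboolT Ux).

End Submodules.

(** * Projective dimension through syzygies *)

Section ProjectiveDimensionBounds.
Variable R : nzRingType.
Implicit Types A B C P X Z : lmodType R.

Definition linear_of A B (f : A -> B) (fL : linear f) : {linear A -> B} :=
  HB.pack f (GRing.isLinear.Build R A B *:%R f fL).

Lemma linear_ofE A B (f : A -> B) (fL : linear f) x : linear_of fL x = f x.
Proof. by []. Qed.

Lemma submod_val_linear A (U : submod A) : linear (@submod_val R A U).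
Proof. by []. Qed.

Definition submod_incl A (U : submod A) := linear_of (@submod_val_linear A U).

Fact ker_submodL A B (f : {linear A -> B}) a u v :
  f u = 0 -> f v = 0 -> f (a *: u + v) = 0.
Proof. by move=> fu fv; rewrite linearP fu fv scaler0 addr0. Qed.

Definition ker_submod A B (f : {linear A -> B}) : submod A :=
  @Submod _ _ (fun x => f x = 0) (linear0 f) (@ker_submodL A B f).

Fact id_linear A : linear (@id A). Proof. by []. Qed.

(** The kernel of the identity is a concrete zero module with which resolutions can end. *)
Definition zero_submod A : submod A := ker_submod (linear_of (@id_linear A)).

Lemma zero_submodP A (x : submod_type (zero_submod A)) : x = 0.
Proof. by apply: val_inj; apply: (submod_valP x). Qed.

Record exact3 A B C (i : {linear A -> B}) (g : {linear B -> C}) : Prop := Exact3 {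
  exact3_inj : injective i;
  exact3_surj : surjective g;
  exact3_mid : forall x, g x = 0 <-> exists z, i z = x
}.

Lemma exact3_comp A B C (i : {linear A -> B}) (g : {linear B -> C}) :
  exact3 i g -> forall z, g (i z) = 0.
Proof. by move=> ex z; apply/(exact3_mid ex); exists z. Qed.

Lemma exact3_ker A B (g : {linear A -> B}) :
  surjective g -> exact3 (submod_incl (ker_submod g)) g.
Proof.
move=> gS; split=> //; first exact: val_inj.
move=> x; split=> [gx|[z <-]]; last exact: (submod_valP z).
by exists (@to_submod _ _ (ker_submod g) x gx).
Qed.

Lemma linear_factor A B C (i : {linear B -> C}) (f : {linear A -> C}) :
  injective i -> (forall x, exists y, i y = f x) ->
  exists h : {linear A -> B}, forall x, i (h x) = f x.
Proof.
move=> ii /choice [h hE]; have hL : linear h.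
  by move=> a u v; apply: ii; rewrite linearP !hE linearP.
by exists (linear_of hL).
Qed.

Lemma linear_section A B (g : {linear A -> B}) :
  projective B -> surjective g -> exists s : {linear B -> A}, forall x, g (s x) = x.
Proof.
move=> PB gS; have idL : linear (@id B) by [].
by have [h hE] := PB _ _ g (linear_of idL) gS; exists h.
Qed.

Lemma projective_retract A P (s : {linear A -> P}) (q : {linear P -> A}) :
  (forall x, q (s x) = x) -> projective P -> projective A.
Proof.
move=> qs PP B C g f gS.
have fqL : linear (fun x => f (q x)) by move=> a u v; rewrite !linearP.
have [h hE] := PP _ _ g (linear_of fqL) gS.
have hsL : linear (fun x => h (s x)) by move=> a u v; rewrite !linearP.
by exists (linear_of hsL) => x; rewrite !linear_ofE hE /= qs.
Qed.

Lemma projective_bij A B (g : {linear A -> B}) :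
  injective g -> surjective g -> projective A -> projective B.
Proof.
move=> gI gS; have [s sE] := choice gS.
have sL : linear s by move=> a u v; apply: gI; rewrite linearP !sE.
exact: (projective_retract (s := linear_of sL) sE).
Qed.

Lemma projective_zero A : (forall x : A, x = 0) -> projective A.
Proof.
move=> A0 B C g f gS; have zL : linear (fun _ : A => 0 : B).
  by move=> a u v; rewrite scaler0 addr0.
by exists (linear_of zL) => x /=; rewrite (A0 x) !linear0.
Qed.

Lemma projective_regular : projective (R^o : lmodType R).
Proof.
move=> B C g f gS; have [b gb] := gS (f 1).
have hL : linear (fun x : R^o => (x : R) *: b).
  by move=> a u v; rewrite scalerDl scalerA.
exists (linear_of hL) => x /=.
by rewrite linearZ gb -linearZ; congr (f _); rewrite /GRing.scale /= mulr1.
Qed.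

Lemma projective_ext A B C (i : {linear A -> B}) (g : {linear B -> C}) :
  exact3 i g -> projective A -> projective C -> projective B.
Proof.
move=> ex PA PC D E q f qS.
have [s sE] := linear_section PC (exact3_surj ex).
have [t tE] : exists t : {linear B -> A}, forall x, i (t x) = x - s (g x).
  have fL : linear (fun x => x - s (g x)).
    by move=> a u v; rewrite !linearP /= scalerDr addrACA.
  apply: (linear_factor (f := linear_of fL) (exact3_inj ex)) => x.
  by apply/(exact3_mid ex); rewrite linearB /= sE subrr.
have fiL : linear (fun x => f (i x)) by move=> a u v; rewrite !linearP.
have fsL : linear (fun x => f (s x)) by move=> a u v; rewrite !linearP.
have [hA hAE] := PA _ _ q (linear_of fiL) qS.
have [hC hCE] := PC _ _ q (linear_of fsL) qS.
have hL : linear (fun x => hA (t x) + hC (g x)).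
  by move=> a u v; rewrite !linearP scalerDr addrACA.
exists (linear_of hL) => x /=.
by rewrite linearD hAE hCE /= tE linearB subrK.
Qed.

Lemma snd_linear A B : linear (fun x : A * B => x.2). Proof. by []. Qed.

Lemma exact3_prod A B : exists (i : {linear A -> (A * B)%type})
  (g : {linear (A * B)%type -> B}), exact3 i g.
Proof.
have iL : linear (fun x : A => (x, 0) : A * B).
  by move=> a u v; congr pair; rewrite /= scaler0 addr0.
exists (linear_of iL), (linear_of (@snd_linear A B)); split => /=.
- by move=> x y [].
- by move=> b; exists (0, b).
- by case=> a b /=; split=> [->|[z [_ <-]]//]; exists a.
Qed.

(** Projective dimension at most p, unfolded one syzygy at a time: an induction on p then handles a
    single short exact sequence instead of a complex. *)
Fixpoint pdle (p : nat) (M : lmodType R) : Prop :=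
  if p is p'.+1 then
    exists (P Z : lmodType R) (i : {linear Z -> P}) (g : {linear P -> M}),
      [/\ projective P, exact3 i g & pdle p' Z]
  else projective M.

Lemma pdleS p M : pdle p M -> pdle p.+1 M.
Proof.
elim: p M => [|p IHp] M; last first.
  case=> P [Z] [i] [g] [PP ex Zp]; exists P, Z, i, g; split=> //.
  exact: IHp.
move=> PM; exists M, (submod_type (zero_submod M)),
  (submod_incl (zero_submod M)), (linear_of (@id_linear M)); split=> //.
- by apply: (exact3_ker (g := linear_of (@id_linear M))) => x; exists x.
- by apply: projective_zero => x; apply: zero_submodP.
Qed.

Lemma pdle_leq p q M : (p <= q)%N -> pdle p M -> pdle q M.
Proof.
by move=> /subnK <-; elim: (q - p)%N => // d IHd /IHd; apply: pdleS.
Qed.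

Lemma pdle_projective p M : projective M -> pdle p M.
Proof. exact: (@pdle_leq 0). Qed.

(* Horseshoe lemma: a lift to B of the cover of C makes the direct sum of the
   covers of A and C a cover of B, and the kernels form a short exact sequence. *)
Lemma pdle_ext p A B C (i : {linear A -> B}) (g : {linear B -> C}) :
  exact3 i g -> pdle p A -> pdle p C -> pdle p B.
Proof.
elim: p A B C i g => [|p IHp] A B C i g ex; first exact: projective_ext ex.
case=> P1 [Z1] [i1] [g1] [PP1 ex1 pZ1] [P2] [Z2] [i2] [g2] [PP2 ex2 pZ2].
have [t tE] := PP2 _ _ g g2 (exact3_surj ex).
have GL : linear (fun x : P1 * P2 => i (g1 x.1) + t x.2).
  by move=> a u v; rewrite !linearP /= scalerDr addrACA.
pose G := linear_of GL.
have GS : surjective G.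
  move=> b; have [b2 b2E] := exact3_surj ex2 (g b).
  have /(exact3_mid ex) [a aE] : g (b - t b2) = 0 by rewrite linearB /= tE b2E subrr.
  have [b1 b1E] := exact3_surj ex1 a.
  by exists (b1, b2); rewrite /G linear_ofE /= b1E aE subrK.
exists (P1 * P2)%type, (submod_type (ker_submod G)),
  (submod_incl (ker_submod G)), G; split.
- have [j [q exq]] := exact3_prod P1 P2.
  exact: projective_ext exq PP1 PP2.
- exact: exact3_ker.
have j1P x : ker_submod G (i1 x, 0).
  by rewrite /= (exact3_comp ex1) !linear0 addr0.
have j1L : linear (fun x => to_submod (j1P x)).
  by move=> a u v; apply: val_inj; congr pair; rewrite /= ?linearP // scaler0 addr0.
have [q qE] : exists q : {linear submod_type (ker_submod G) -> Z2},
    forall x, i2 (q x) = (submod_val x).2.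
  have fL : linear (fun x : submod_type (ker_submod G) => (submod_val x).2) by [].
  apply: (linear_factor (f := linear_of fL) (exact3_inj ex2)) => x.
  apply/(exact3_mid ex2); rewrite -tE /=.
  have := submod_valP x => /= /(congr1 g).
  by rewrite linearD /= (exact3_comp ex) add0r linear0.
apply: (IHp _ _ _ (linear_of j1L) q) => //; split.
- move=> x y /(congr1 (fun z => (submod_val z).1)) /=; exact: (exact3_inj ex1).
- move=> z2; have /(exact3_mid ex) [a aE] : g (t (i2 z2)) = 0.
    by rewrite tE (exact3_comp ex2).
  have [b1 b1E] := exact3_surj ex1 (- a).
  have kP : ker_submod G (b1, i2 z2) by rewrite /= b1E -aE linearN addNr.
  by exists (to_submod kP); apply: (exact3_inj ex2); rewrite qE.
- move=> x; split=> [/(congr1 i2)|[z <-]]; last first.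
    by apply: (exact3_inj ex2); rewrite qE /= linear0.
  rewrite qE linear0 => x2.
  have := submod_valP x; rewrite /= x2 linear0 addr0 => x1.
  have /(exact3_mid ex1) [z zE] : g1 (submod_val x).1 = 0.
    by apply: (exact3_inj ex); rewrite x1 linear0.
  by exists z; apply: val_inj; rewrite /= zE -x2; case: (submod_val x).
Qed.

Lemma comp_linear A B C (f : {linear A -> B}) (g : {linear B -> C}) :
  linear (fun x => g (f x)).
Proof. by move=> a u v; rewrite !linearP. Qed.

(** The cover P of B also covers C, and its kernel over C is an extension of A by its kernel over
    B. *)
Lemma pdle_coker p A B C (i : {linear A -> B}) (g : {linear B -> C}) :
  exact3 i g -> pdle p A -> pdle p.+1 B -> pdle p.+1 C.
Proof.
move=> ex pA [P] [Z] [j] [q] [PP exq pZ].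
pose h := linear_of (comp_linear q g).
have hS : surjective h.
  move=> c; have [b <-] := exact3_surj ex c.
  by have [y <-] := exact3_surj exq b; exists y.
exists P, (submod_type (ker_submod h)), (submod_incl (ker_submod h)), h.
split=> //; first exact: exact3_ker.
have jP z : ker_submod h (j z) by rewrite /= (exact3_comp exq) linear0.
have jL : linear (fun x => to_submod (jP x)).
  by move=> a u v; apply: val_inj; rewrite /= linearP.
have [r rE] : exists r : {linear submod_type (ker_submod h) -> A},
    forall x, i (r x) = q (submod_val x).
  have fL : linear (fun x : submod_type (ker_submod h) => q (submod_val x)).
    by move=> a u v; rewrite /= linearP.
  apply: (linear_factor (f := linear_of fL) (exact3_inj ex)) => x.
  by apply/(exact3_mid ex); apply: (submod_valP x).
apply: (pdle_ext (i := linear_of jL) (g := r)) => //; split.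
- move=> x y /(congr1 val) /=; exact: (exact3_inj exq).
- move=> a; have [y yE] := exact3_surj exq (i a).
  have yP : ker_submod h y by rewrite /= yE (exact3_comp ex).
  by exists (to_submod yP); apply: (exact3_inj ex); rewrite rE.
- move=> x; split=> [/(congr1 i)|[z <-]].
    rewrite rE linear0 => /(exact3_mid exq) [z zE].
    by exists z; apply: val_inj.
  by apply: (exact3_inj ex); rewrite rE /= (exact3_comp exq) linear0.
Qed.

(* The pullback X of g and of a projective cover of C is an extension of B by
   the syzygy of C, and an extension of the cover by A, which splits. *)
Lemma pdle_kernel p A B C (i : {linear A -> B}) (g : {linear B -> C}) :
  exact3 i g -> pdle p B -> pdle p.+1 C -> pdle p A.
Proof.
move=> ex pB [P] [Z] [j] [q] [PP exq pZ].
have dL : linear (fun x : B * P => g x.1 - q x.2).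
  by move=> a u v; rewrite !linearP /= scalerDr addrACA.
pose X := ker_submod (linear_of dL).
have XE (x : submod_type X) : g (submod_val x).1 = q (submod_val x).2.
  by have /eqP := submod_valP x; rewrite /= subr_eq0 => /eqP.
have jP z : X (0, j z) by rewrite /= (exact3_comp exq) linear0 subr0.
have jL : linear (fun x => to_submod (jP x)).
  by move=> a u v; apply: val_inj; congr pair; rewrite /= ?linearP // scaler0 addr0.
have bL : linear (fun x : submod_type X => (submod_val x).1) by [].
have pL : linear (fun x : submod_type X => (submod_val x).2) by [].
have pX : pdle p (submod_type X).
  apply: (pdle_ext (i := linear_of jL) (g := linear_of bL)) => //; split.
  - move=> x y /(congr1 (fun x => (submod_val x).2)) /=; exact: (exact3_inj exq).
  - move=> b; have [y yE] := exact3_surj exq (g b).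
    have yP : X (b, y) by rewrite /= yE subrr.
    by exists (to_submod yP).
  - move=> x; split=> [x1|[z <-]//]; rewrite linear_ofE in x1.
    have := XE x; rewrite x1 linear0 => /esym /(exact3_mid exq) [z zE].
    by exists z; apply: val_inj; rewrite /= zE -x1; case: (submod_val x).
have pS : surjective (linear_of pL).
  move=> y; have [b bE] := exact3_surj ex (q y).
  have yP : X (b, y) by rewrite /= bE subrr.
  by exists (to_submod yP).
have [s sE] := linear_section PP pS.
have sE2 y : (submod_val (s y)).2 = y := sE y.
have aP a : X (i a, 0) by rewrite /= (exact3_comp ex) linear0 subr0.
have aL : linear (fun x => to_submod (aP x)).
  by move=> a u v; apply: val_inj; congr pair; rewrite /= ?linearP // scaler0 addr0.
have [r rE] : exists r : {linear submod_type X -> A},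
    forall x, i (r x) = (submod_val (x - s (submod_val x).2)).1.
  have fL : linear (fun x : submod_type X =>
      (submod_val (x - s (submod_val x).2)).1).
    by move=> a u v /=; rewrite !linearP /= scalerDr addrACA.
  apply: (linear_factor (f := linear_of fL) (exact3_inj ex)) => x.
  apply/(exact3_mid ex); rewrite linear_ofE XE /=.
  by rewrite sE2 subrr linear0.
have ra a : r (to_submod (aP a)) = a.
  by apply: (exact3_inj ex); rewrite rE /= linear0 subr0.
have rs y : r (s y) = 0.
  apply: (exact3_inj ex); rewrite rE linear0.
  by rewrite sE2 subrr.
have si : injective s by move=> x y xy; rewrite -(sE x) xy sE.
(* The splitting makes A a retract of X, which settles p = 0, and also the quotient of X by the copy
   [s] of the projective P, to which [pdle_coker] applies when p > 0. *)
case: p {pB pZ} pX => [|p] pX.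
  exact: (projective_retract (s := linear_of aL) (q := r)).
apply: (pdle_coker (i := s) (g := r) (A := P)) pX; last exact: pdle_projective.
split=> //; first by move=> a; exists (to_submod (aP a)).
move=> x; split=> [/(congr1 i)|[z <-]//].
rewrite rE linear0 => x1; exists (submod_val x).2.
apply/eqP; rewrite -subr_eq0 -opprB oppr_eq0; apply/eqP; apply: val_inj.
rewrite [RHS]/=; move: x1; set y := x - _ => y1.
have y2 : (submod_val y).2 = 0.
  by rewrite /y /= sE2 subrr.
by clearbody y; case: y y1 y2 => -[a b] yP /= -> ->.
Qed.

Lemma pdle_resolution p M : pdle p M -> projective_resolution_of_length M p.
Proof.
elim: p M => [|p IHp] M.
  move=> PM; set U := submod_type (zero_submod M).
  pose P i : lmodType R := if i is 0 then M else U.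
  have dL i : linear (fun _ : P i.+1 => 0 : P i).
    by move=> a u v; rewrite scaler0 addr0.
  exists P, (fun i => linear_of (dL i)), (linear_of (@id_linear M)); split.
  - by case=> [//|i]; apply: projective_zero (@zero_submodP M).
  - by move=> x; exists x.
  - move=> x; split=> [/= ->|[y <-]]; first by exists 0.
    by rewrite linear_ofE.
  - by move=> i x; split=> // _; exists 0; rewrite linear0; apply/esym/zero_submodP.
  - by case=> // i _ x; apply: zero_submodP.
case=> P [Z] [j] [q] [PP ex /IHp [Q] [d] [eps] [QP epsS d0 dS Qp]].
pose P' i : lmodType R := if i is i'.+1 then Q i' else P.
pose d' i : {linear P' i.+1 -> P' i} :=
  match i with 0 => linear_of (comp_linear eps j) | i'.+1 => d i' end.
exists P', d', q; split.
- by case.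
- exact: exact3_surj ex.
- move=> x; rewrite (exact3_mid ex); split=> [[z <-]|[y <-]].
    by have [y <-] := epsS z; exists y.
  by exists (eps y).
- case=> [|i] x /=; last exact: dS.
  rewrite -d0; split=> [/= jx|->]; last by rewrite linear0.
  by apply: (exact3_inj ex); rewrite jx linear0.
- by case=> // i ip x; apply: Qp.
Qed.

Lemma resolution_pdle p M : projective_resolution_of_length M p -> pdle p M.
Proof.
elim: p M => [|p IHp] M [P] [d] [eps] [PP epsS d0 dS Pp].
  apply: projective_bij epsS (PP 0%N) => x y /eqP.
  rewrite -subr_eq0 -linearB => /eqP /d0 [z zE].
  by apply/eqP; rewrite -subr_eq0 -zE (Pp 1%N _ z) // linear0.
exists (P 0%N), (submod_type (ker_submod eps)), (submod_incl (ker_submod eps)), eps.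
split=> //; first exact: exact3_ker.
apply: IHp; exists (fun i => P i.+1), (fun i => d i.+1).
have [e eE] : exists e : {linear P 1%N -> submod_type (ker_submod eps)},
    forall x, submod_val (e x) = d 0%N x.
  have [e eE] : exists e : {linear P 1%N -> submod_type (ker_submod eps)},
     forall x, submod_incl (ker_submod eps) (e x) = d 0%N x.
    apply: linear_factor; first exact: val_inj.
    move=> x; have kP : ker_submod eps (d 0%N x) by apply/d0; exists x.
    by exists (to_submod kP).
  by exists e.
exists e; split=> //.
- by move=> x; have /d0 [y yE] := submod_valP x; exists y; apply: val_inj; apply: etrans (eE y) _.
- move=> x; rewrite -dS; split=> [/(congr1 (@submod_val _ _ _))|dx].
    by rewrite eE.
  by apply: val_inj; apply: etrans (eE x) _.
- by move=> i ip x; apply: Pp.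
Qed.

End ProjectiveDimensionBounds.
(** * Koszul homology *)

Section Koszul.
Variables (R : comNzRingType) (n : nat).
Implicit Types (M N P Z : lmodType R) (A B : {set 'I_n}) (x y : 'I_n -> R).

(** The sign in e_u e_A = ± e_B, with B = [u |: A] and u outside A, when basis vectors are
    multiplied in increasing order. *)
Definition ksign (u : 'I_n) A : R := (-1) ^+ #|[set a in A | (a < u)%N]|.

Lemma ksign_sqr u A : ksign u A * ksign u A = 1.
Proof. by rewrite /ksign -exprD addnn -mul2n exprM sqrrN expr1n expr1n. Qed.

Lemma ksign0 u : ksign u set0 = 1.
Proof.
rewrite /ksign (_ : [set a in _ | _] = set0) ?cards0 //.
by apply/setP=> a; rewrite !inE.
Qed.

Lemma ksign_swap u w A : u != w -> u \notin A -> w \notin A ->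
  ksign u A * ksign w (u |: A) = - (ksign w A * ksign u (w |: A)).
Proof.
wlog uw : u w / (u < w)%N => [th uw uA wA|].
  have := uw; rewrite -val_eqE neq_ltn => /orP[/th|/th]; first exact.
  by move=> -> //; rewrite ?opprK // eq_sym.
move=> _ uA wA; rewrite /ksign.
have -> : [set a in u |: A | (a < w)%N] = u |: [set a in A | (a < w)%N].
  by apply/setP=> a; rewrite !inE; case: eqP => [->|]; rewrite ?uw.
have -> : [set a in w |: A | (a < u)%N] = [set a in A | (a < u)%N].
  apply/setP=> a; rewrite !inE; case: eqP => [->|] //=.
  by rewrite ltnNge ltnW // andbF.
by rewrite cardsU1 !inE (negPf uA) /= add1n exprS; ring.
Qed.

(* The Koszul complex on x_1, ..., x_n with coefficients in M: a chain has its
   coefficient on e_A at A, and chains of all degrees are mixed. *)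
Definition kd x M (c : {set 'I_n} -> M) A : M :=
  \sum_(u | u \notin A) (ksign u A * x u) *: c (u |: A).

Lemma eq_kd x M (c c' : {set 'I_n} -> M) : c =1 c' -> kd x c =1 kd x c'.
Proof. by move=> cc A; apply: eq_bigr => u _; rewrite cc. Qed.

Lemma kdD x M (c c' : {set 'I_n} -> M) A :
  kd x (fun A => c A + c' A) A = kd x c A + kd x c' A.
Proof. by rewrite -big_split; apply: eq_bigr => u _; rewrite scalerDr. Qed.

Lemma kdN x M (c : {set 'I_n} -> M) A : kd x (fun A => - c A) A = - kd x c A.
Proof. by rewrite -sumrN; apply: eq_bigr => u _; rewrite scalerN. Qed.

Lemma kdB x M (c c' : {set 'I_n} -> M) A :
  kd x (fun A => c A - c' A) A = kd x c A - kd x c' A.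
Proof. by rewrite kdD kdN. Qed.

Lemma kdZ x M (c : {set 'I_n} -> M) a A : kd x (fun A => a *: c A) A = a *: kd x c A.
Proof.
by rewrite scaler_sumr; apply: eq_bigr => u _; rewrite !scalerA mulrC.
Qed.

Lemma kd0 x M (c : {set 'I_n} -> M) A : (forall A, c A = 0) -> kd x c A = 0.
Proof. by move=> c0; rewrite /kd big1 // => u _; rewrite c0 scaler0. Qed.

Lemma kd_sum x M (I : Type) (r : seq I) (Q : pred I) (c : I -> {set 'I_n} -> M) A :
  kd x (fun A => \sum_(i <- r | Q i) c i A) A = \sum_(i <- r | Q i) kd x (c i) A.
Proof. by rewrite /kd [RHS]exchange_big /=; apply: eq_bigr => u _; rewrite scaler_sumr. Qed.

Lemma kd_linear x M N (f : {linear M -> N}) (c : {set 'I_n} -> M) A :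
  kd x (fun A => f (c A)) A = f (kd x c A).
Proof. by rewrite /kd linear_sum /=; apply: eq_bigr => u _; rewrite linearZ. Qed.

Lemma kd_add x y M (c : {set 'I_n} -> M) A :
  kd (fun u => x u + y u) c A = kd x c A + kd y c A.
Proof. by rewrite -big_split; apply: eq_bigr => u _; rewrite mulrDr scalerDl. Qed.

Lemma kd_submod x M (U : submod M) (c : {set 'I_n} -> M) A :
  (forall A, U (c A)) -> U (kd x c A).
Proof. by move=> Uc; apply: submod_sum => u _; apply: submodZ. Qed.

Lemma kd_kd x M (c : {set 'I_n} -> M) A : kd x (kd x c) A = 0.
Proof.
pose a u w := ksign u A * x u * (ksign w (u |: A) * x w) *: c (w |: (u |: A)).
transitivity (\sum_u \sum_w if [&& u \notin A, w \notin A & u != w] then a u w else 0).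
  rewrite /kd big_mkcond; apply: eq_bigr => u _.
  case: (boolP (u \in A)) => uA /=; first by rewrite big1.
  rewrite scaler_sumr [LHS]big_mkcond; apply: eq_bigr => w _.
  by rewrite !inE negb_or eq_sym andbC; case: ifP => //; rewrite scalerA.
(* Only the terms with u < w are kept in [b]. By [ksign_swap] the others are their opposites, so the
   whole sum is that of [b] minus its transpose. *)
pose b u w : M := if [&& u \notin A, w \notin A & (u < w)%N] then a u w else 0.
rewrite -[RHS](subrr (\sum_u \sum_w b u w)) [X in _ - X]exchange_big -sumrB; apply: eq_bigr => u _.
rewrite -sumrB; apply: eq_bigr => w _; rewrite /b.
case: (boolP (u \in A)) => uA /=; first by rewrite !(andbF, subrr).
case: (boolP (w \in A)) => wA /=; first by rewrite !(andbF, subrr).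
rewrite -val_eqE /=; case: ltngtP => uw /=; rewrite ?subr0 ?sub0r ?subrr //.
rewrite /a setUCA -scaleNr; congr (_ *: _).
rewrite mulrACA ksign_swap //; first by ring.
by rewrite -val_eqE /= gtn_eqF.
Qed.

(** The value at [set0] is never read by [kd], so it can be reset to 0 without changing the
    boundary. *)
Lemma kd_reduce x M (c : {set 'I_n} -> M) :
  kd x c =1 kd x (fun A => if A == set0 then 0 else c A).
Proof.
move=> A; apply: eq_bigr => u _; case: eqP => // uA.
by have := in_set0 u; rewrite -uA !inE eqxx.
Qed.

(** Left multiplication by e_v in the exterior algebra. *)
Definition kwedge v M (c : {set 'I_n} -> M) A : M :=
  if v \in A then ksign v (A :\ v) *: c (A :\ v) else 0.

(** The homotopy formula d(e_v c) + e_v d(c) = x_v c: each x_v, hence every element of the ideal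
    (x), acts as zero on Koszul homology. *)
Lemma kd_kwedge x v M (c : {set 'I_n} -> M) A :
  kd x (kwedge v c) A = x v *: c A - kwedge v (kd x c) A.
Proof.
rewrite /kwedge; case: (boolP (v \in A)) => vA; last first.
  rewrite subr0 /kd (bigD1 v) //= big1 ?addr0 => [|u /andP[uA uv]]; last first.
    by rewrite !inE eq_sym (negPf uv) (negPf vA) scaler0.
  by rewrite !inE eqxx /= setU1K // scalerA mulrAC ksign_sqr mul1r.
set B := A :\ v; have AE : A = v |: B by rewrite setD1K.
have vB : v \notin B by rewrite !inE eqxx.
rewrite [kd x c B]/kd (bigD1 v) //= -AE scalerDr scalerA mulrA ksign_sqr mul1r.
rewrite opprD addNKr -scaleNr scaler_sumr.
apply: eq_big => [u|u uA]; first by rewrite AE !inE negb_or andbC.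
have uB : u \notin B by move: uA; rewrite AE !inE negb_or => /andP[].
have uv : u != v by move: uA; rewrite AE !inE negb_or => /andP[].
rewrite !inE vA orbT.
have -> : (u |: A) :\ v = u |: B.
  by rewrite AE setUCA setU1K // in_setU1 negb_or eq_sym uv.
rewrite !scalerA; congr (_ *: _).
have := ksign_swap uv uB vB; rewrite -AE => E.
have -> : ksign u A = - (ksign v B * ksign u B * ksign v (u |: B)).
  by rewrite -mulrA E mulrN opprK mulrA ksign_sqr mul1r.
transitivity (- (ksign v B * ksign u B * x u) * (ksign v (u |: B) * ksign v (u |: B))).
  by ring.
by rewrite ksign_sqr; ring.
Qed.

End Koszul.

(** * Acyclicity of the Koszul complex of a regular sequence *)

Section KoszulAcyclic.
Variables (R : comNzRingType) (n : nat) (x : 'I_n -> R).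

(** Vanishing of homology in all positive degrees at once. The condition at [set0] sets aside degree
    0, where the homology is M/(x)M. *)
Definition kacyclic (M : lmodType R) : Prop :=
  forall c : {set 'I_n} -> M, c set0 = 0 -> (forall A, kd x c A = 0) ->
  exists w, kd x w =1 c.

(** The x_j are added from the last to the first, each being regular modulo those after it. The
    induction is on the number m of trailing variables in which the chain is supported, as for the
    mapping cone of x_j. *)
Lemma kd_acyclic_regular :
  (forall j s, (exists a, x j * s = \sum_(u < n | (j < u)%N) a u * x u) ->
     exists b, s = \sum_(u < n | (j < u)%N) b u * x u) ->
  kacyclic R^o.
Proof.
move=> Hx c; pose T j := [set i : 'I_n | (j <= i)%N].
suff H m (e : {set 'I_n} -> R^o) : (m <= n)%N -> e set0 = 0 ->
    (forall A, kd x e A = 0) ->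
    (forall A : {set 'I_n}, ~~ (A \subset T (n - m)%N) -> e A = 0) ->
    exists w, [/\ kd x w =1 e, w set0 = 0 &
      forall A : {set 'I_n}, ~~ (A \subset T (n - m)%N) -> w A = 0].
  move=> c0 cc; have [A|w [wE _ _]] := H n c (leqnn _) c0 cc; last by exists w.
  by case/negP; apply/subsetP=> i _; rewrite inE subnn.
elim: m e => [|m IHm] e mn e0 ek es.
  exists (fun _ => 0); split=> // A; rewrite kd0 //.
  have [->//|[i iA]] := set_0Vmem A; rewrite es //.
  apply/negP => /subsetP/(_ i iA); rewrite inE subn0 leqNgt.
  by rewrite ltn_ord.
have jn : (n - m.+1 < n)%N by lia.
pose j := Ordinal jn; have jE : (n - m = j.+1)%N by rewrite /=; lia.
have {}IHm e' := IHm e' (ltnW mn); rewrite {}jE in IHm.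
have Tj u : (u \in T j.+1) = (j < u)%N by rewrite inE.
have jT (A : {set 'I_n}) : A \subset T j.+1 -> j \notin A.
  by move=> /subsetP AT; apply/negP => /AT; rewrite Tj ltnn.
have subTj (A : {set 'I_n}) : j \notin A -> (j |: A \subset T (n - m.+1)%N) = (A \subset T j.+1).
  move=> jA; apply/subsetP/subsetP => H u; last first.
    by rewrite in_setU1 => /orP[/eqP->|/H]; rewrite !inE //; apply: ltnW.
  move=> uA; have := H u; rewrite in_setU1 uA orbT => /(_ isT).
  rewrite !inE leq_eqVlt => /orP[/eqP ju|//].
  by rewrite -(_ : u = j) ?uA // in jA; apply/val_inj.
have subTj0 (A : {set 'I_n}) : j \notin A -> (A \subset T (n - m.+1)%N) = (A \subset T j.+1).
  by move=> jA; rewrite -subTj // subUset sub1set inE leqnn.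
(* The factor of e_j in [e], a chain in the variables after j; up to sign it is again a cycle. *)
pose e1 (A : {set 'I_n}) : R^o := if j \in A then 0 else e (j |: A).
have e1s (A : {set 'I_n}) : ~~ (A \subset T j.+1) -> e1 A = 0.
  by rewrite /e1; case: ifP => // /negbT jA AT; rewrite es ?subTj.
have e1k A : kd x e1 A = 0.
  have [jA|jA] := boolP (j \in A).
    by rewrite kd_reduce /kd big1 // => u _; rewrite /e1 !inE jA orbT if_same scaler0.
  have [AT|AT] := boolP (A \subset T j.+1); last first.
    rewrite /kd big1 // => u _; rewrite e1s ?scaler0 //.
    by apply: contra AT; apply: subset_trans; apply: subsetUr.
  transitivity (- kd x e (j |: A)); last by rewrite ek oppr0.
  rewrite /kd -sumrN (bigD1 j jA) /= /e1 !inE eqxx /= scaler0 add0r.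
  apply: eq_big => [u|u /andP[uA uj]]; first by rewrite !inE negb_or andbC.
  rewrite !inE eq_sym (negPf uj) (negPf jA) /= setUCA.
  have [uT|uT] := boolP (u \in T j.+1); last first.
    rewrite es ?scaler0 ?oppr0 // setUCA subTj; last by rewrite !inE eq_sym (negPf uj).
    by apply: contra uT => /subsetP; apply; rewrite !inE eqxx.
  rewrite -scaleNr; congr (_ *: _); rewrite -mulNr; congr (_ * _).
  rewrite /ksign (_ : [set a in j |: A | _] = j |: [set a in A | (a < u)%N]).
    by rewrite cardsU1 inE (negPf jA) /= add1n exprS mulN1r opprK.
  by apply/setP=> a; rewrite !inE; case: eqP => [->|]; rewrite -?Tj ?uT.
(* The induction hypothesis does not reach degree 0. The cycle condition for [e] at [set0] puts x_j
   times [e1 set0] in the ideal of the later x_u, and regularity then makes [e1 set0] a boundary. *)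
have [t [ts t0 tE]] : exists t : {set 'I_n} -> R^o,
    [/\ forall A : {set 'I_n}, ~~ (A \subset T j.+1) -> t A = 0, t set0 = 0 &
        kd x t set0 = e1 set0].
  have [|b bE] := Hx j (e1 set0).
    exists (fun u => - e [set u]).
    have := ek set0; rewrite /kd (bigD1 j) /=; last by rewrite inE.
    move/eqP; rewrite addr_eq0 => /eqP; rewrite setU0 /e1 inE setU0.
    rewrite ksign0 mul1r => xe; rewrite -[LHS]/(x j *: (e [set j] : R^o)) xe -sumrN.
    rewrite [LHS]big_mkcond [RHS]big_mkcond; apply: eq_bigr => u _.
    rewrite inE /= ksign0 mul1r setU0.
    have [->|uj] := eqVneq u j; first by rewrite ltnn.
    case: ifP => ju; first by rewrite /GRing.scale /=; ring.
    rewrite es ?scaler0 ?oppr0 // sub1set inE -/(nat_of_ord j) leq_eqVlt.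
    by rewrite ju orbF -val_eqE eq_sym in uj *.
  exists (fun A : {set 'I_n} => \sum_(u : 'I_n | (j < u)%N && (A == [set u])) b u : R^o); split.
  - move=> A AT; rewrite big1 // => u /andP[ju /eqP AE]; case/negP: AT.
    by rewrite AE sub1set Tj.
  - rewrite big1 // => u /andP[_ /eqP /setP/(_ u)].
    by rewrite !inE eqxx.
  - rewrite bE /kd [RHS]big_mkcond; apply: eq_big => u; first by rewrite inE.
    move=> _; rewrite setU0 ksign0 mul1r; case: ifP => ju.
      rewrite (big_pred1 u) => [|v]; first by rewrite /GRing.scale /= mulrC.
      apply/andP/eqP => [[_ /eqP /set1_inj]|->] //; split=> //.
    rewrite big1 ?scaler0 // => v /andP[jv /eqP/set1_inj uv].
    by rewrite uv jv in ju.
have [|A|A AT|w1 [w1E w10 w1s]] := IHm (fun A => e1 A - kd x t A).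
- by rewrite tE subrr.
- by rewrite kdB e1k kd_kd subr0.
- rewrite e1s // /kd big1 ?subr0 // => u _; rewrite ts ?scaler0 //.
  by apply: contra AT; apply: subset_trans; apply: subsetUr.
pose w A : R^o := t A + w1 A.
have wE A : kd x w A = e1 A by rewrite kdD w1E addrC subrK.
have ws (A : {set 'I_n}) : ~~ (A \subset T j.+1) -> w A = 0.
  by move=> AT; rewrite /w ts // w1s // addr0.
(* As the boundary of [w] is [e1], adding the boundary of e_j w cancels every term of [e] that
   contains e_j and leaves a cycle in the later variables. *)
have [||A AT|w2 [w2E w20 w2s]] := IHm (fun A => e A + kd x (kwedge j w) A).
- rewrite e0 add0r kd_kwedge /kwedge inE subr0 /w t0 w10 addr0 scaler0 //.
- by move=> A; rewrite kdD ek kd_kd addr0.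
- rewrite kd_kwedge ws // scaler0 sub0r /kwedge; case: ifP => [jA|/negbT jA].
    rewrite wE /e1 !inE eqxx /= setD1K //.
    have -> : ksign R j (A :\ j) *: e A = e A.
      have [AT'|/es->] := boolP (A \subset T (n - m.+1)%N); last by rewrite scaler0.
      rewrite /ksign (_ : [set _ in _ | _] = set0) ?cards0 ?scale1r //.
      apply/setP=> a; rewrite !inE; case: (boolP (a \in A)) => aA; last by rewrite andbF.
      have := subsetP AT' a aA; rewrite inE => ja.
      by rewrite [(_ < _)%N]ltnNge ja andbF.
    by rewrite subrr.
  by rewrite subr0 es // subTj0.
exists (fun A => w2 A - kwedge j w A); split.
- by move=> A; rewrite kdB w2E addrK.
- by rewrite w20 /kwedge inE subr0.
- move=> A AT; rewrite /kwedge; case: ifP => [jA|/negbT jA].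
    have jD : j \notin A :\ j by rewrite !inE eqxx.
    rewrite ws; last by rewrite -subTj // setD1K.
    rewrite scaler0 subr0 w2s //; apply/negP => /jT; by rewrite jA.
  by rewrite subr0 w2s // -subTj0.
Qed.

End KoszulAcyclic.

(** * Vanishing of Koszul homology above the projective dimension *)

Section FreeLift.
Variables (R : nzRingType) (M : lmodType R).

(** The free module on the underlying set of M maps onto M, so a projective M is a retract of it;
    acyclicity is thereby reduced to free modules. *)
Definition free_lift (D : {freeg M / R}) : M := fglift id D.

HB.instance Definition _ := GRing.isAdditive.Build {freeg M / R} M free_lift
  (lift_is_additive id).

Lemma free_lift_linear : linear free_lift.
Proof.
move=> a u v; rewrite raddfD /=; congr (_ + _).
have E w : free_lift w = \sum_(z <- dom w) coeff z w *: z.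
  by rewrite -{1}[w]freeg_sumE raddf_sum; apply: eq_bigr => z _; apply: liftU.
rewrite raddf_sum /= E scaler_sumr; apply: eq_bigr => z _.
by rewrite /free_lift liftU scalerA.
Qed.

Lemma free_lift_surj : surjective free_lift.
Proof. by move=> x; exists << x >>; rewrite /free_lift liftU scale1r. Qed.

End FreeLift.

Section KoszulVanishing.
Variables (R : comNzRingType) (n : nat) (x : 'I_n -> R).
Hypothesis acyR : kacyclic x R^o.

(** The equation is solved coordinate by coordinate, over the finite list [D] of generators that
    occur in the values of c. *)
Lemma kacyclic_free (T : choiceType) : kacyclic x {freeg T / R}.
Proof.
move=> c c0 cc.
have coeffL z : linear (coeff z : {freeg T / R} -> R^o).
  by move=> a u v; rewrite coeffD coeffZ.
have /choice [w wE] z : exists w : {set 'I_n} -> R^o, forall A, kd x w A = coeff z (c A).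
  apply: acyR => [|A]; first by rewrite c0 coeff0.
  by rewrite (kd_linear x (linear_of (@coeffL z))) cc /= coeff0.
pose D := undup (flatten [seq dom (c A) | A : {set 'I_n}]).
pose W A : {freeg T / R} := \sum_(z <- D) << w z A *g z >>.
exists W => A.
apply/eqP/freeg_eqP => y.
rewrite -[coeff y (kd x W A)]/(linear_of (@coeffL y) (kd x W A)) -kd_linear /=.
have [yD|yD] := boolP (y \in D).
  rewrite -wE; apply: (@eq_kd _ _ x R^o _ (w y)) => B.
  rewrite raddf_sum /= (bigD1_seq y) ?undup_uniq //= coeffU eqxx mulr1 big1 ?addr0 //.
  by move=> z zy; rewrite coeffU (negPf zy) mulr0.
rewrite kd0 => [|B].
  apply/esym/coeff_outdom; apply: contra yD => yA.
  rewrite mem_undup; apply/flattenP; exists (dom (c A)) => //.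
  by apply/mapP; exists A; rewrite ?mem_enum.
rewrite raddf_sum /= big_seq big1 // => z zD; rewrite coeffU.
case: eqP => [zy|_]; last by rewrite mulr0.
by rewrite -zy zD in yD.
Qed.

Lemma kacyclic_projective (P : lmodType R) : projective P -> kacyclic x P.
Proof.
move=> PP c c0 cc.
have [s sE] := linear_section (g := linear_of (@free_lift_linear R P)) PP
  (@free_lift_surj R P).
have [|A|w wE] := @kacyclic_free P (fun A => s (c A)).
- by rewrite c0 linear0.
- by rewrite kd_linear cc linear0.
exists (fun A => free_lift (w A)) => A.
by rewrite (kd_linear x (linear_of (@free_lift_linear R P))) wE sE.
Qed.

(** Dimension shifting: a cycle c lifts to a chain y in P whose boundary lies in the syzygy Z, one
    degree lower, where the induction applies. Vanishing on the sets with at most q elements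
    expresses that the degrees exceed q. *)
Lemma pdle_koszul_vanish q (M : lmodType R) (c : {set 'I_n} -> M) : pdle q M ->
  (forall A : {set 'I_n}, (#|A| <= q)%N -> c A = 0) -> (forall A, kd x c A = 0) ->
  exists w, kd x w =1 c.
Proof.
elim: q M c => [|q IHq] M c.
  by move=> PM c0; apply: kacyclic_projective => //; apply: c0; rewrite cards0.
case=> P [Z] [i] [g] [PP ex pZ] c0 cc.
(* The lift is 0 wherever c is, so that the boundary of y vanishes on the sets with at most q
   elements. *)
have /choice [y yE] A : exists y, g y = c A /\ (c A = 0 -> y = 0).
  have [cA|/eqP cA] := eqVneq (c A) 0; first by exists 0; rewrite linear0.
  by have [y yA] := exact3_surj ex (c A); exists y.
have /choice [z zE] A : exists z, i z = kd x y A.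
  apply/(exact3_mid ex); rewrite -kd_linear -[RHS](cc A).
  by apply: eq_kd => B; have [] := yE B.
have [||w wE] := IHq Z z pZ.
- move=> A Aq; apply: (exact3_inj ex); rewrite zE linear0 /kd big1 // => u uA.
  have [_ ->] := yE (u |: A); first by rewrite scaler0.
  by apply: c0; rewrite cardsU1 uA.
- move=> A; apply: (exact3_inj ex); rewrite -kd_linear linear0.
  by rewrite (eq_kd x zE) kd_kd.
(* Acyclicity concerns chains that vanish at [set0]: y does, and w is reset there so that y - i w'
   does too. *)
pose w' A := if A == set0 then 0 else w A.
have w'E A : kd x w' A = z A by rewrite -kd_reduce wE.
have [|A|v vE] := kacyclic_projective PP (c := fun A => y A - i (w' A)).
- have [_ ->] := yE set0; first by rewrite /w' eqxx linear0 subr0.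
  by apply: c0; rewrite cards0.
- by rewrite kdB kd_linear w'E zE subrr.
exists (fun A => g (v A)) => A; rewrite kd_linear vE linearB (exact3_comp ex) subr0.
by have [] := yE A.
Qed.

End KoszulVanishing.
(** * Weakly regular sequences *)

Section WeaklyRegular.
Variable R : comNzRingType.
Implicit Types (I J : submod (R^o : lmodType R)) (f g : R) (fs : seq R).

Lemma submod_mull I a g : I g -> I (a * g). Proof. exact: submodZ. Qed.

Lemma submod_mulr I a g : I g -> I (g * a). Proof. by rewrite mulrC; apply: submod_mull. Qed.

Fact submod_add0 I J : exists2 u, I u & J (0 - u).
Proof. by exists 0; [apply: submod0 | rewrite subrr; apply: submod0]. Qed.

Fact submod_addL I J (a : R) (v w : R^o) :
  (exists2 u, I u & J (v - u)) -> (exists2 u, I u & J (w - u)) ->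
  exists2 u, I u & J (a *: v + w - u).
Proof.
move=> [u Iu Jvu] [u' Iu' Jwu]; exists (a *: u + u'); first exact: submodL.
have -> : a *: v + w - (a *: u + u') = a *: (v - u) + (w - u').
  by rewrite scalerBr opprD addrACA.
exact: submodL.
Qed.

Definition submod_add I J := Submod (submod_add0 I J) (@submod_addL I J).

Fact submod_cap0 I J : I 0 /\ J 0. Proof. by split; apply: submod0. Qed.

Fact submod_capL I J (a : R) (v w : R^o) :
  I v /\ J v -> I w /\ J w -> I (a *: v + w) /\ J (a *: v + w).
Proof. by move=> [Iv Jv] [Iw Jw]; split; apply: submodL. Qed.

Definition submod_cap I J := Submod (submod_cap0 I J) (@submod_capL I J).

Fact adjoin0 I f : exists a, I (0 - a * f).
Proof. by exists 0; rewrite mul0r subrr; apply: submod0. Qed.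

Fact adjoinL I f (a : R) (v w : R^o) :
  (exists b, I (v - b * f)) -> (exists b, I (w - b * f)) ->
  exists b, I (a *: v + w - b * f).
Proof.
move=> [b Ib] [c Ic]; exists (a * b + c).
have -> : a *: v + w - (a * b + c) * f = a *: (v - b * f) + (w - c * f).
  by rewrite /GRing.scale /=; ring.
exact: submodL.
Qed.

Definition adjoin I f := Submod (adjoin0 I f) (@adjoinL I f).

Lemma adjoin_incl I f g : I g -> adjoin I f g.
Proof. by exists 0; rewrite mul0r subr0. Qed.

Lemma adjoin_self I f a : adjoin I f (a * f).
Proof. by exists a; rewrite subrr; apply: submod0. Qed.

Definition nzd I f := forall g, I (f * g) -> I g.

(** Regularity on R/I apart from properness, which [one_notin_irrelevant] supplies for the
    Stanley-Reisner ring. *)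
Fixpoint wregular I fs : Prop :=
  if fs is f :: fs' then nzd I f /\ wregular (adjoin I f) fs' else True.

Lemma wregular_rcons I fs f :
  wregular I (rcons fs f) <-> wregular I fs /\ nzd (foldl adjoin I fs) f.
Proof.
elim: fs I => [|g fs IHfs] I /=; first by split=> [[? _]|[_ ?]].
by rewrite IHfs; split=> [[? [? ?]]|[[? ?] ?]].
Qed.

Lemma wregularP I fs : wregular I fs <->
  forall i, (i < size fs)%N -> nzd (foldl adjoin I (take i fs)) fs`_i.
Proof.
elim: fs I => [|f fs IHfs] I /=; first by split=> // _ [].
rewrite IHfs; split=> [[fI H] [|i]|H] //=; first exact: H.
by split=> [|i ifs]; [apply: (H 0%N) | apply: (H i.+1)].
Qed.

Lemma adjoinsP I fs g : foldl adjoin I fs g <->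
  exists c : nat -> R, I (g - \sum_(i < size fs) c i * fs`_i).
Proof.
elim: fs I => [|f fs IHfs] I /=.
  split=> [Ig|[c]]; last by rewrite big_ord0 subr0.
  by exists (fun=> 0); rewrite big_ord0 subr0.
rewrite IHfs; split=> [[c [a Ia]]|[c]].
  exists (fun i => if i is i'.+1 then c i' else a).
  by rewrite big_ord_recl /= opprD addrA addrAC.
rewrite big_ord_recl /= => Ic; exists (fun i => c i.+1), (c 0%N).
by rewrite opprD addrA in Ic; rewrite addrAC.
Qed.

Lemma submod_add_adjoin I J f :
  adjoin (submod_add I J) f = submod_add (adjoin I f) (adjoin J f).
Proof.
apply: submod_ext => g; split=> [[a [u Iu Ju]]|[u [a Ia] [b Jb]]].
  exists u; first exact: adjoin_incl.
  by exists a; rewrite addrAC.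
exists (a + b), (u - a * f) => //.
have -> : g - (a + b) * f - (u - a * f) = g - u - b * f by ring.
exact: Jb.
Qed.

(** If g is a f modulo I and b f modulo J, then f (a - b) lies in I + J, hence so does a - b;
    subtracting from a the I-part u of a - b gives one coefficient valid modulo both. *)
Lemma submod_cap_adjoin I J f : nzd (submod_add I J) f ->
  adjoin (submod_cap I J) f = submod_cap (adjoin I f) (adjoin J f).
Proof.
move=> fIJ; apply: submod_ext => g; split=> [[a [Ia Ja]]|]; first by split; exists a.
move=> [[a Ia] [b Jb]].
have [|u Iu Ju] := fIJ (a - b).
  exists (- (g - a * f)); first exact: submodN.
  have -> : f * (a - b) - - (g - a * f) = g - b * f by ring.
  exact: Jb.
exists (a - u); split.
  have -> : g - (a - u) * f = g - a * f + u * f by ring.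
  by apply: submodD => //; apply: submod_mulr.
have -> : g - (a - u) * f = g - b * f - (a - b - u) * f by ring.
by apply: submodB => //; apply: submod_mulr.
Qed.

(* 0 -> R/(I & J) -> R/I x R/J -> R/(I + J) -> 0 stays exact modulo f_1, ..., f_i
   as long as these are regular on R/(I + J). *)
Lemma wregular_cap I J fs : wregular I fs -> wregular J fs ->
  wregular (submod_add I J) (take (size fs).-1 fs) -> wregular (submod_cap I J) fs.
Proof.
elim: fs I J => //= f fs IHfs I J [fI Ifs] [fJ Jfs] IJfs; split.
  by move=> g [Ig Jg]; split; [apply: fI | apply: fJ].
case: fs IHfs Ifs Jfs IJfs => // f' fs IHfs Ifs Jfs [fIJ IJfs].
rewrite submod_cap_adjoin //; apply: IHfs => //.
by rewrite -submod_add_adjoin.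
Qed.

End WeaklyRegular.

(** * Koszul homology bounds the length of regular sequences *)

Section DepthBound.
Variables (R : comNzRingType) (n : nat) (x : 'I_n -> R).
Implicit Types (I : submod (R^o : lmodType R)) (c w : {set 'I_n} -> R^o).

(* H_j(x; R/I) is nonzero for some j >= i. *)
Definition koszul_nonzero I i : Prop :=
  exists c, [/\ forall A : {set 'I_n}, (#|A| < i)%N -> c A = 0,
    forall A, I (kd x c A) & ~ exists w, forall A, I (c A - kd x w A)].

Lemma koszul_nonzero_leq I i : koszul_nonzero I i -> (i <= n)%N.
Proof.
move=> [c [c0 _ cw]]; rewrite leqNgt; apply/negP => ni; apply: cw.
exists (fun=> 0) => A; rewrite kd0 // c0 ?subr0; first exact: submod0.
by apply: leq_ltn_trans ni; rewrite -[X in (_ <= X)%N]card_ord max_card.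
Qed.

(* f annihilates the Koszul homology, so that the connecting map
   H_{i+1}(x; R/(I + f)) -> H_i(x; R/I) is surjective. *)
Lemma koszul_nonzero_adjoin I i f :
  nzd I f -> (exists b, f = \sum_u b u * x u) ->
  koszul_nonzero I i -> koszul_nonzero (adjoin I f) i.+1.
Proof.
move=> fI [b fE] [c [c0 cI cw]].
(* By [kd_kwedge] the boundary of y is f c modulo I, so y is a cycle modulo f which the connecting
   map sends to c. *)
pose y A : R^o := \sum_u b u *: kwedge u c A.
have yE A : I (kd x y A - f * c A).
  rewrite kd_sum; under eq_bigr do rewrite kdZ kd_kwedge scalerBr.
  rewrite sumrB fE mulr_suml.
  under [X in X - _ - _]eq_bigr do rewrite scalerA /GRing.scale /=.
  rewrite addrAC subrr sub0r; apply/submodN/submod_sum => u _.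
  apply: submodZ; rewrite /kwedge; case: ifP => _; last exact: submod0.
  exact/submodZ/cI.
exists y; split.
- move=> A Ai; rewrite /y big1 // => u _; rewrite /kwedge.
  case: ifP => uA; last by rewrite scaler0.
  by rewrite c0 ?scaler0 //; rewrite (cardsD1 u) uA in Ai.
- by move=> A; exists (c A); rewrite mulrC.
case=> w wE; apply: cw.
have /choice [v vE] : forall A, exists v : R^o, I (y A - kd x w A - v * f) by [].

(* From y = d w + f v modulo I, applying d gives f c = f d v modulo I, and f cancels. *)
exists v => A; apply: fI.
have -> : f * (c A - kd x v A) = (kd x y A - f * kd x v A) - (kd x y A - f * c A).
  by ring.
apply: submodB => //.
have -> : kd x y A - f * kd x v A
    = kd x (fun A => y A - kd x w A - f *: (v A : R^o)) A.
  by rewrite !kdB kd_kd subr0 kdZ.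
by apply: kd_submod => B; rewrite /GRing.scale /= [f * _]mulrC; apply: vE.
Qed.

Lemma wregular_size I i fs : koszul_nonzero I i -> wregular I fs ->
  (forall f, f \in fs -> exists b, f = \sum_u b u * x u) -> (i + size fs <= n)%N.
Proof.
elim: fs I i => [|f fs IHfs] I i kI /=.
  by rewrite addn0 => _ _; apply: koszul_nonzero_leq kI.
case=> fI fsI fsx; rewrite addnS -addSn.
apply: IHfs fsI _ => [|g gfs]; last by apply: fsx; rewrite inE gfs orbT.
by apply: koszul_nonzero_adjoin => //; apply: fsx; rewrite inE eqxx.
Qed.

End DepthBound.
(** * Face ideals *)

Section FaceIdeals.
Variables (K : fieldType) (n : nat).
Local Notation S := {mpoly K[n]}.
Implicit Types (p q f g : S) (m : 'X_{1..n}) (A B : {set 'I_n}) (D : {set {set 'I_n}}).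
Implicit Types I J : submod (S^o : lmodType S).

Definition mfilter (Q : pred 'X_{1..n}) p : S := \sum_(m <- msupp p | Q m) p@_m *: 'X_[m].

Lemma mcoeff_mfilter Q p m : (mfilter Q p)@_m = if Q m then p@_m else 0.
Proof.
rewrite /mfilter raddf_sum /= big_mkcond /=.
have [mp|mp] := boolP (m \in msupp p); last first.
  rewrite (memN_msupp_eq0 mp) if_same big_seq big1 // => m' m'p.
  case: ifP => // _; rewrite mcoeffZ mcoeffX; case: eqP => [E|]; rewrite ?mulr0 //.
  by rewrite -E m'p in mp.
rewrite (bigD1_seq m) ?msupp_uniq //= big1 ?addr0 => [|m' mm'].
  by case: ifP => // _; rewrite mcoeffZ mcoeffX eqxx mulr1.
by case: ifP => // _; rewrite mcoeffZ mcoeffX (negPf mm') mulr0.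
Qed.

Lemma mcoeffM_eq0 p q m :
  (forall m1 m2, m = (m1 + m2)%MM -> p@_m1 = 0 \/ q@_m2 = 0) -> (p * q)@_m = 0.
Proof.
move=> pq; rewrite mcoeffM big1 // => k /eqP /pq [->|->]; first by rewrite mul0r.
by rewrite mulr0.
Qed.

(** Membership in a monomial ideal is tested on monomials; each monomial of p is assigned by [pick]
    to one generator dividing it. *)
Lemma monomial_ideal (I : finType) (Q : pred I) (h : I -> 'X_{1..n}) p :
  (forall m, m \in msupp p -> exists2 i, Q i & (h i <= m)%MM) ->
  exists c : I -> S, p = \sum_(i | Q i) c i * 'X_[h i].
Proof.
move=> pQ; pose k m := [pick i | Q i && (h i <= m)%MM].
exists (fun i => \sum_(m <- msupp p | k m == Some i) p@_m *: 'X_[m - h i]).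
under eq_bigr do rewrite mulr_suml.
rewrite (exchange_big_dep predT) //= {1}[p]mpolyE.
rewrite big_seq [RHS]big_seq; apply: eq_bigr => m mp.
have [i Qi im] := pQ m mp; rewrite /k; case: pickP => [j /andP[Qj jm]|/(_ i)].
  rewrite (big_pred1 j) => [|i']; first by rewrite -scalerAl -mpolyXD submK.
  by rewrite /= eq_sym (inj_eq Some_inj); case: eqP => [->|]; rewrite ?Qj ?andbF.
by rewrite Qi im.
Qed.

Definition msup m : {set 'I_n} := [set i | m i != 0%N].

Lemma msupD m1 m2 : msup (m1 + m2)%MM = msup m1 :|: msup m2.
Proof. by apply/setP=> i; rewrite !inE mnmDE addn_eq0 negb_and. Qed.

Lemma msup0 : msup 0%MM = set0.
Proof. by apply/setP=> i; rewrite !inE mnm0E. Qed.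

Lemma msup1 i : msup U_(i)%MM = [set i].
Proof. by apply/setP=> j; rewrite !inE mnm1E [j == i]eq_sym; case: (i == j). Qed.

(** Membership in the complex generated by [D], which may consist of the facets alone or of all the
    faces. *)
Definition covered D A := [exists B in D, A \subset B].

Lemma coveredS D A B : A \subset B -> covered D B -> covered D A.
Proof.
move=> AB /existsP[C /andP[CD BC]]; apply/existsP; exists C.
by rewrite CD (subset_trans AB BC).
Qed.

Lemma covered1 A B : covered [set A] B = (B \subset A).
Proof.
apply/existsP/idP => [[C /andP[/set1P->]]//|BA].
by exists A; rewrite inE eqxx.
Qed.

Lemma coveredU D D' A : covered (D :|: D') A = covered D A || covered D' A.
Proof.
apply/existsP/orP => [[B /andP[]]|[] /existsP[B /andP[BD AB]]].
- by rewrite inE => /orP[] BD AB; [left|right]; apply/existsP; exists B; rewrite BD.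
- by exists B; rewrite inE BD.
- by exists B; rewrite inE BD orbT.
Qed.

Fact face_ideal0 D m : covered D (msup m) -> (0 : S)@_m = 0.
Proof. by rewrite mcoeff0. Qed.

Fact face_idealL D (a : S) (u v : S^o) :
  (forall m, covered D (msup m) -> u@_m = 0) ->
  (forall m, covered D (msup m) -> v@_m = 0) ->
  forall m, covered D (msup m) -> (a *: u + v)@_m = 0.
Proof.
move=> uD vD m mD; rewrite mcoeffD vD // addr0; apply: mcoeffM_eq0 => m1 m2 mE.
by right; apply: uD; apply: coveredS mD; rewrite mE msupD subsetUr.
Qed.

(* The Stanley-Reisner ideal of the complex with set of facets D. *)
Definition face_ideal D : submod (S^o : lmodType S) :=
  @Submod S (S^o : lmodType S) (fun p => forall m, covered D (msup m) -> p@_m = 0)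
    (@face_ideal0 D) (@face_idealL D).

Lemma face_idealU D D' :
  face_ideal (D :|: D') = submod_cap (face_ideal D) (face_ideal D').
Proof.
apply: submod_ext => p; split=> [pDD|[pD pD'] m]; last first.
  by rewrite coveredU => /orP[/pD|/pD'].
by split=> m mD; apply: pDD; rewrite coveredU mD ?orbT.
Qed.

(** The monomials whose support is not a face of [D] go to the first ideal; the remaining ones
    belong to the second. *)
Lemma face_ideal_add D D' E :
  (forall A, covered E A = covered D A && covered D' A) ->
  submod_add (face_ideal D) (face_ideal D') = face_ideal E.
Proof.
move=> ED; apply: submod_ext => p; split=> [[u uD puD'] m|pE].
  rewrite ED => /andP[mD mD']; have := puD' m mD'.
  by rewrite mcoeffB (uD m mD) subr0.
exists (mfilter (fun m => ~~ covered D (msup m)) p) => m mD.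
  by rewrite mcoeff_mfilter mD.
rewrite mcoeffB mcoeff_mfilter; case: ifP => [_|/negbFE mD']; first by rewrite subrr.
by rewrite pE ?subr0 // ED mD mD'.
Qed.

Lemma nzd_face_ideal_X A a : a \in A -> nzd (face_ideal [set A]) ('X_a : S).
Proof.
move=> aA p pA m; rewrite covered1 => mA.
rewrite -(mcoeffMX p U_(a) m) mulrC; apply: pA.
by rewrite covered1 msupD msup1 subUset sub1set aA.
Qed.

Lemma adjoin_face_ideal_X A a : a \in A ->
  adjoin (face_ideal [set A]) ('X_a : S) = face_ideal [set A :\ a].
Proof.
move=> aA; apply: submod_ext => p; split=> [[b pb] m|pA].
  rewrite covered1 subsetD1 => /andP[mA ma]; apply/eqP.
  rewrite -[p](subrK (b * 'X_a)) mcoeffD pb ?covered1 // add0r; apply/eqP.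
  apply: mcoeffM_eq0 => m1 m2 mE; right; rewrite mcoeffX; case: eqP => // m2E.
  by move: ma; rewrite mE -m2E msupD msup1 !inE eqxx orbT.
have [|c cE] := @monomial_ideal unit xpredT (fun _ => U_(a)%MM)
    (mfilter (fun m => a \in msup m) p).
  move=> m; rewrite mcoeff_msupp mcoeff_mfilter; case: ifP => [ma _|]; last by rewrite eqxx.
  by exists tt => //; rewrite lep1mP; rewrite inE in ma.
exists (c tt) => m; rewrite covered1 => mA.
have -> : c tt * 'X_a = mfilter (fun m => a \in msup m) p.
  by rewrite cE (big_pred1 tt) //; case.
rewrite mcoeffB mcoeff_mfilter; case: ifP => [_|/negbT ma]; first exact: subrr.
by rewrite subr0 pA // covered1 subsetD1 mA.
Qed.

Definition homogeneous_ideal (I : submod (S^o : lmodType S)) :=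
  forall d p, I p -> I (pihomog mdeg d p).

Lemma mcoeff_pihomog d p m : (pihomog mdeg d p)@_m = if mdeg m == d then p@_m else 0.
Proof. exact: (mcoeff_mfilter (fun m => mdeg m == d)). Qed.

Lemma homogeneous_face_ideal D : homogeneous_ideal (face_ideal D).
Proof. by move=> d p pD m mD; rewrite mcoeff_pihomog pD // if_same. Qed.

Lemma pihomogM c f d p : f \is c.-homog ->
  pihomog mdeg d (p * f) = if (c <= d)%N then pihomog mdeg (d - c) p * f else 0.
Proof.
move=> fc; rewrite {1}(pihomog_partitionE (leqnn (msize p))) mulr_suml.
rewrite raddf_sum /=.
have piE i : pihomog mdeg d (pihomog mdeg i p * f) =
    if (i + c == d)%N then pihomog mdeg i p * f else 0.
  have h : pihomog mdeg i p * f \is (i + c).-homog by apply: dhomogM (pihomogP _ _ _) fc.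
  case: eqP => [<-|/eqP ne]; first by rewrite pihomog_dE.
  exact: pihomog_ne0 ne h.
under eq_bigr do rewrite piE.
case: leqP => cd; last first.
  by rewrite big1 // => i _; case: eqP => // E; rewrite -E ltnNge leq_addl in cd.
rewrite -big_mkcond /=; case: (ltnP (d - c) (msize p)) => dp.
  by rewrite (big_pred1 (Ordinal dp)) // => i /=; rewrite -val_eqE /=; lia.
rewrite big1 => [|i /eqP E].
  rewrite [pihomog _ _ _](_ : _ = 0) ?mul0r //; apply/mpolyP => m.
  rewrite mcoeff_pihomog mcoeff0; case: eqP => // E; apply/memN_msupp_eq0.
  by apply: msize_mdeg_ge; rewrite E.
by have := ltn_ord i; lia.
Qed.

Lemma homogeneous_adjoin I c f : homogeneous_ideal I -> f \is c.-homog ->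
  homogeneous_ideal (adjoin I f).
Proof.
move=> Ih fc d p [a Ia]; have := Ih d _ Ia; rewrite pihomogB (pihomogM _ _ fc).
case: ifP => _ H; first by exists (pihomog mdeg (d - c) a).
by exists 0; rewrite mul0r.
Qed.

(** The half of the permutability of a regular sequence x, f that holds in every commutative ring.
    The other half, regularity of f modulo I, is [nzd_homogeneous]. *)
Lemma nzd_swap I (x f : S) : nzd I x -> nzd (adjoin I x) f -> nzd (adjoin I f) x.
Proof.
move=> xI fI g [b Ib]; have [|a Ia] := fI b.
  exists g; rewrite -opprB; apply: submodN.
  by have -> : g * x - f * b = x * g - b * f by ring.
exists a; apply: xI.
have -> : x * (g - a * f) = x * g - b * f + f * (b - a * x) by ring.
by apply: submodD => //; apply: submod_mull.
Qed.

(* Descending induction on the degree replaces the Krull intersection theorem: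
   a homogeneous g killed by f lies in I + (x), so g = b x modulo I with
   deg b < deg g, and f kills b as well. *)
Lemma nzd_homogeneous I c e (x f : S) : homogeneous_ideal I -> (0 < e)%N ->
  f \is c.-homog -> x \is e.-homog -> nzd I x -> nzd (adjoin I x) f -> nzd I f.
Proof.
move=> Ih e0 fc xe xI fI g Ifg.
suff H d : forall g, g \is d.-homog -> I (f * g) -> I g.
  rewrite (pihomog_partitionE (leqnn (msize g))); apply: submod_sum => d _.
  apply: H; first exact: pihomogP.
  have := Ih (d + c)%N _ Ifg; rewrite mulrC (pihomogM _ _ fc) leq_addl addnK.
  by rewrite mulrC.
elim/ltn_ind: d => d IHd {Ifg} {}g gd Ifg.
have [|b Ib] := fI g; first exact: adjoin_incl.
have := Ih d _ Ib; rewrite pihomogB (pihomogM _ _ xe) pihomog_dE //.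
case: leqP => ed; last by rewrite subr0.
set b' := pihomog _ _ b => Ib'.
rewrite -[g](subrK (b' * x)); apply: submodD => //. apply: submod_mulr.
apply: (IHd (d - e)%N); [lia | exact: pihomogP |].
apply: xI; have -> : x * (f * b') = f * g - f * (g - b' * x) by ring.
by apply: submodB => //; apply: submod_mull.
Qed.

Lemma nzd_congr I (f g : S) : I (f - g) -> nzd I g -> nzd I f.
Proof.
move=> fg gI h Ifh; apply: gI.
have -> : g * h = f * h - (f - g) * h by ring.
by apply: submodB => //; apply: submod_mulr.
Qed.

Lemma nzd_prod I (T : Type) (r : seq T) (Q : pred T) (F : T -> S) :
  (forall i, Q i -> nzd I (F i)) -> nzd I (\prod_(i <- r | Q i) F i).
Proof.
move=> FI; apply: big_ind => // [g|f f' fI f'I g]; first by rewrite mul1r.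
by rewrite -mulrA => /fI /f'I.
Qed.

Definition mesyms k : seq S := mkseq (fun i => mesym n K i.+1) k.

Lemma adjoin_comm I f g : adjoin (adjoin I f) g = adjoin (adjoin I g) f.
Proof.
by apply: submod_ext => h; split=> [[b [a H]]|[b [a H]]]; exists a, b; rewrite addrAC.
Qed.

Lemma foldl_adjoin I (fs : seq S) g :
  adjoin (foldl (@adjoin S) I fs) g = foldl (@adjoin S) (adjoin I g) fs.
Proof. by elim: fs I => //= f fs IHfs I; rewrite IHfs adjoin_comm. Qed.

Lemma foldl_adjoin_incl I (fs : seq S) g : I g -> foldl (@adjoin S) I fs g.
Proof. by elim: fs I => //= f fs IHfs I Ig; apply/IHfs/adjoin_incl. Qed.

Lemma mesyms_rcons k : mesyms k.+1 = rcons (mesyms k) (mesym n K k.+1).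
Proof. exact: mkseqS. Qed.

Lemma homogeneous_mesyms I k : homogeneous_ideal I ->
  homogeneous_ideal (foldl (@adjoin S) I (mesyms k)).
Proof.
elim: k => [//|k IHk] Ih; rewrite mesyms_rcons -cats1 foldl_cat /=.
by apply: homogeneous_adjoin (IHk Ih) _; apply: dhomog_mesym.
Qed.

Lemma mesym1_prod A : \prod_(i in A) 'X_i = 'X_[mesym1 A] :> S.
Proof.
rewrite mpolyXE_id big_mkcond; apply: eq_bigr => i _.
by rewrite mnmE; case: (i \in A); rewrite ?expr1 ?expr0.
Qed.

Lemma msup_mesym1 A : msup (mesym1 A) = A.
Proof. by apply/setP=> i; rewrite inE mnmE; case: (i \in A). Qed.

(** Every other squarefree monomial of degree |A| involves a variable outside A. *)
Lemma mesym_face A : face_ideal [set A] (mesym n K #|A| - \prod_(a in A) 'X_a).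
Proof.
move=> m; rewrite covered1 => mA; rewrite mesymE (bigD1 A) //=.
rewrite mesym1_prod addrAC subrr add0r raddf_sum /= big1 // => h /andP[/eqP hA ne].
rewrite mcoeffX; case: eqP => // E; case/eqP: ne; apply/eqP.
rewrite eqEcard hA leqnn andbT; by rewrite -[h]msup_mesym1 E.
Qed.

(* Induction on #|A|: setting a variable x_a to 0 replaces A by A :\ a, and
   e_{#|A|} becomes the product of the variables in A. *)
Lemma nzd_mesym A k : (k < #|A|)%N ->
  (forall a, a \in A -> nzd (foldl (@adjoin S) (face_ideal [set A]) (mesyms k)) 'X_a) /\
  nzd (foldl (@adjoin S) (face_ideal [set A]) (mesyms k)) (mesym n K k.+1).
Proof.
move: {2}#|A|.+1 (ltnSn #|A|) => N; elim: N A k => // N IHN A k.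
rewrite ltnS => AN kA.
have IHD a l : a \in A -> (l < #|A|.-1)%N ->
    nzd (adjoin (foldl (@adjoin S) (face_ideal [set A]) (mesyms l)) 'X_a)
        (mesym n K l.+1).
  move=> aA lA; rewrite foldl_adjoin adjoin_face_ideal_X //.
  have AE := cardsD1 a A; rewrite aA in AE.
  by apply: (IHN (A :\ a) l _ _).2; lia.
(* x_a is moved past e_1, ..., e_l one at a time by [nzd_swap], each being regular modulo x_a by
   induction on A. *)
have X l a : (l < #|A|)%N -> a \in A ->
    nzd (foldl (@adjoin S) (face_ideal [set A]) (mesyms l)) 'X_a.
  elim: l => [|l IHl] lA aA; first exact: nzd_face_ideal_X.
  rewrite mesyms_rcons -cats1 foldl_cat /=; apply: nzd_swap; first by apply: IHl => //; lia.
  by apply: IHD => //; lia.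
split=> [a aA|]; first exact: X.
(* When k + 1 = |A|, the polynomial e_{k+1} vanishes on [A :\ a], and the product of the variables
   is used instead; otherwise regularity is lifted from x_a = 0. *)
have [kA'|kA'] := ltnP k #|A|.-1; last first.
  have -> : k.+1 = #|A| by lia.
  apply: nzd_congr; first by apply: foldl_adjoin_incl; apply: mesym_face.
  by apply: nzd_prod => a aA; apply: X.
have [a aA] : exists a, a \in A by apply/card_gt0P; lia.
apply: (@nzd_homogeneous _ k.+1 1 'X_a) => //.
- by apply: homogeneous_mesyms; apply: homogeneous_face_ideal.
- by apply: dhomog_mesym.
- by rewrite dhomogX; apply/eqP/mdeg1.
- exact: X.
- exact: IHD.
Qed.

Lemma wregular_mesyms A k : (k <= #|A|)%N -> wregular (face_ideal [set A]) (mesyms k).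
Proof.
elim: k => [|k IHk] // kA; rewrite mesyms_rcons; apply/wregular_rcons.
by split; [apply: IHk; apply: ltnW | have [] := nzd_mesym kA].
Qed.

End FaceIdeals.

(** * Projective dimension of sums and intersections of ideals *)

Section IdealProjectiveDimension.
Variable R : comNzRingType.
Implicit Types (I J : submod (R^o : lmodType R)) (x : R).

Lemma pdle_prod p (M N : lmodType R) : pdle p M -> pdle p N -> pdle p (M * N)%type.
Proof. by have [i [g ex]] := exact3_prod M N; apply: pdle_ext ex. Qed.

(** Apply [pdle_kernel] to 0 -> I n J -> I x J -> I + J -> 0, with maps a |-> (a, -a) and (u, v) |->
    u + v. *)
Lemma pdle_cap p I J :
  pdle p (submod_type I) -> pdle p (submod_type J) ->
  pdle p.+1 (submod_type (submod_add I J)) -> pdle p (submod_type (submod_cap I J)).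
Proof.
move=> pI pJ; pose C := submod_type (submod_cap I J).
have gP (y : submod_type I * submod_type J) :
    submod_add I J (submod_val y.1 + submod_val y.2).
  exists (submod_val y.1); first exact: submod_valP.
  by rewrite addrC addKr; apply: submod_valP.
have gL : linear (fun y => to_submod (gP y)).
  by move=> a u v; apply: val_inj; rewrite /= scalerDr addrACA.
pose iI (a : C) := to_submod (proj1 (submod_valP a)).
pose iJ (a : C) := to_submod (submodN (proj2 (submod_valP a))).
have iL : linear (fun a : C => (iI a, iJ a)).
  move=> a u v; congr pair; apply: val_inj => //=.
  by rewrite opprD scalerN.
apply: (pdle_kernel (i := linear_of iL) (g := linear_of gL)); last exact: pdle_prod.
split.
- by move=> a b [ab _]; apply: val_inj.
- move=> y; have [u Iu Ju] := submod_valP y.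
  by exists (to_submod Iu, to_submod Ju); apply: val_inj; rewrite /= addrC subrK.
- move=> [u v]; split=> [/(congr1 (@submod_val _ _ _)) /= uv|[a <-]]; last first.
    by apply: val_inj; rewrite /= subrr.
  have vE : submod_val v = - submod_val u.
    by apply/eqP; rewrite -addr_eq0 addrC; apply/eqP.
  have uP : submod_cap I J (submod_val u).
    split; first exact: submod_valP.
    by rewrite -[submod_val u]opprK -vE; apply/submodN/submod_valP.
  exists (to_submod uP); congr pair; apply: val_inj => //=.
Qed.

(** Apply [pdle_coker] to 0 -> I -> I x R -> I + (x) -> 0, with maps a |-> (x a, -a) and (u, b) |->
    u + b x; regularity of x on R/I gives exactness in the middle. *)
Lemma pdle_adjoin p I x : nzd I x ->
  pdle p (submod_type I) -> pdle p.+1 (submod_type (adjoin I x)).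
Proof.
move=> xI pI.
have gP (y : submod_type I * R^o) : adjoin I x (submod_val y.1 + y.2 * x).
  by exists y.2; rewrite addrK; apply: submod_valP.
have gL : linear (fun y => to_submod (gP y)).
  move=> a u v; apply: val_inj; rewrite /= scalerDr addrACA.
  by congr (_ + _); rewrite /GRing.scale /=; ring.
pose i1 (a : submod_type I) := to_submod (submod_mull x (submod_valP a)).
have iL : linear (fun a : submod_type I => (i1 a, - submod_val a : R^o)).
  move=> a u v; congr pair; first apply: val_inj.
    by rewrite /= /GRing.scale /=; ring.
  by rewrite /= opprD scalerN.
apply: (pdle_coker (i := linear_of iL) (g := linear_of gL)) => //.
  split.
  - by move=> a b [_ /oppr_inj ab]; apply: val_inj.
  - move=> y; have [b Ib] := submod_valP y.
    by exists (to_submod Ib, b : R^o); apply: val_inj; rewrite /= subrK.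
  - move=> [u b]; split=> [/(congr1 (@submod_val _ _ _)) /= ub|[a <-]]; last first.
      by apply: val_inj; rewrite /= mulNr mulrC subrr.
    have uE : submod_val u = - (b * x) by apply/eqP; rewrite -addr_eq0; apply/eqP.
    have bP : I (- b).
      by apply: xI; rewrite mulrN mulrC -uE; apply: submod_valP.
    exists (to_submod bP); congr pair; last by rewrite /= opprK.
    by apply: val_inj; rewrite /= uE mulrN mulrC.
apply: pdleS; apply: pdle_prod => //.
exact/pdle_projective/projective_regular.
Qed.

End IdealProjectiveDimension.

(** * Induction along the tree *)

Section TreeIdeal.
Variables (K : fieldType) (n : nat).
Local Notation S := {mpoly K[n]}.
Local Notation face_ideal := (@face_ideal K n).
Implicit Types (A B : {set 'I_n}).

Lemma face_idealT p : face_ideal [set setT] p -> p = 0.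
Proof. by move=> pT; apply/mpolyP => m; rewrite mcoeff0 pT // covered1 subsetT. Qed.

Lemma face_ideal_setC A v : v \notin A ->
  face_ideal [set A] = adjoin (face_ideal [set v |: A]) ('X_v : S).
Proof. by move=> vA; rewrite adjoin_face_ideal_X ?setU11 ?setU1K. Qed.

Lemma projective_principal : projective (submod_type (face_ideal [set setT])).
Proof. by apply: projective_zero => p; apply/val_inj/face_idealT/submod_valP. Qed.

(** The n - |A| variables outside A are adjoined one at a time, each raising the bound by one except
    the first, whose principal ideal is isomorphic to S; hence [p.+1]. *)
Lemma pdle_face_ideal1 A p : (n - #|A| <= p.+1)%N ->
  pdle p (submod_type (face_ideal [set A])).
Proof.
have T0 (B : {set 'I_n}) : (n <= #|B|)%N -> B = setT.
  by move=> nB; apply/eqP; rewrite eqEcard subsetT cardsT card_ord.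
elim: p A => [|p IHp] A Ap.
  have [/T0->|nA] := leqP n #|A|; first exact: projective_principal.
  have [v vA] : exists v, v \notin A.
    apply/existsP; rewrite -negb_forall; apply: contraL nA => /forallP AT.
    by rewrite -leqNgt (_ : A = setT) ?cardsT ?card_ord //; apply/setP=> i; rewrite AT inE.
  rewrite (face_ideal_setC vA) (T0 (v |: A)); last by rewrite cardsU1 vA; lia.
  have gL : linear (fun s : S^o => to_submod (adjoin_self (face_ideal [set setT]) 'X_v s)).
    by move=> a u w; apply: val_inj; rewrite /= mulrDl scalerAl.
  apply: (projective_bij (g := linear_of gL)); last exact: projective_regular.
    move=> s t /(congr1 (@submod_val _ _ _)) /= /mulIf; apply.
    apply/eqP => /(congr1 (mcoeff U_(v)%MM)) /eqP.
    by rewrite mcoeffXU eqxx mcoeff0 oner_eq0.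
  move=> y; have [b /face_idealT/eqP] := submod_valP y; rewrite subr_eq0 => /eqP yE.
  by exists b; apply: val_inj.
have [Ap'|Ap'] := leqP (n - #|A|) p.+1; first by apply/pdleS/IHp.
have [v vA] : exists v, v \notin A.
  apply/existsP; rewrite -negb_forall; apply: contraL Ap' => /forallP AT.
  rewrite -leqNgt (_ : A = setT) ?cardsT ?card_ord ?subnn //.
  by apply/setP=> i; rewrite AT inE.
rewrite (face_ideal_setC vA); apply: pdle_adjoin.
  by apply: nzd_face_ideal_X; rewrite setU11.
by apply: IHp; rewrite cardsU1 vA; lia.
Qed.

Variables (A sg : nat -> {set 'I_n}).

Fixpoint facets l : {set {set 'I_n}} :=
  if l is l'.+1 then A l' |: facets l' else set0.

Lemma coveredP l B : reflect (exists2 i, (i < l)%N & B \subset A i) (covered (facets l) B).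
Proof.
apply: (iffP idP); elim: l => [|l IHl] /=.
- by move/existsP=> [C]; rewrite inE.
- rewrite coveredU covered1 => /orP[Bl|/IHl [i il Bi]]; first by exists l.
  by exists i => //; apply: ltnW.
- by case.
- move=> [i]; rewrite ltnS leq_eqVlt => /orP[/eqP->|il] Bi.
    by rewrite coveredU covered1 Bi.
  by rewrite coveredU IHl ?orbT //; exists i.
Qed.

(** A fat tree in terms of vertex sets: [sg j] lies in one single earlier facet and contains the
    intersection of [A j] with each of them. *)
Definition tree_data k := forall j, (0 < j < k)%N ->
  [/\ exists2 i, (i < j)%N & sg j \subset A i, sg j \subset A j &
      forall i, (i < j)%N -> A i :&: A j \subset sg j].

Lemma tree_data_glue k j B : tree_data k -> (0 < j < k)%N ->
  (B \subset sg j) = (B \subset A j) && covered (facets j) B.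
Proof.
move=> tA jk; have [[i ij sgi] sgj sgP] := tA j jk.
apply/idP/andP => [Bj|[Bj /coveredP[l lj Bl]]].
  split; first exact: subset_trans Bj sgj.
  by apply/coveredP; exists i; rewrite // (subset_trans Bj sgi).
by apply: subset_trans (sgP l lj); rewrite subsetI Bl.
Qed.

Variables (k e : nat).
Hypothesis tA : tree_data k.
Hypothesis eA : forall i, (i < k)%N -> (e <= #|A i|)%N.
Hypothesis esg : forall j, (0 < j < k)%N -> (e <= #|sg j|.+1)%N.

(** An induction principle for properties of ideals, shared by the regular sequence and the
    projective dimension. *)
Lemma face_ideal_tree (Q : submod (S^o : lmodType S) -> Prop) :
  (forall i, (i < k)%N -> Q (face_ideal [set A i])) ->
  (forall I J j, (0 < j < k)%N -> submod_add I J = face_ideal [set sg j] ->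
     Q I -> Q J -> Q (submod_cap I J)) ->
  (0 < k)%N -> Q (face_ideal (facets k)).
Proof.
move=> QA Qcap k0; suff H l : (l < k)%N -> Q (face_ideal (facets l.+1)).
  by case: k k0 H => // k' _ H; apply: H.
elim: l => [|l IHl] lk; first by rewrite /= setU0; apply: QA.
rewrite /= -/(facets l.+1) face_idealU; apply: (Qcap _ _ l.+1) => //.
- apply: face_ideal_add => B; rewrite !covered1.
  by rewrite (tree_data_glue _ tA).
- exact: QA.
- by apply: IHl; apply: ltnW.
Qed.

Lemma wregular_tree : (0 < k)%N -> wregular (face_ideal (facets k)) (mesyms K n e).
Proof.
apply: (face_ideal_tree (Q := fun I => wregular I (mesyms K n e))) => [i ik|I J j jk IJ eI eJ].
  exact/wregular_mesyms/eA.
apply: wregular_cap => //; rewrite IJ.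
have -> : take (size (mesyms K n e)).-1 (mesyms K n e) = mesyms K n e.-1.
  by case: e => // e'; rewrite mesyms_rcons size_rcons -cats1 take_size_cat.
by apply: wregular_mesyms; have := esg jk; lia.
Qed.

Lemma pdle_tree p : (n - e <= p.+1)%N -> (0 < k)%N ->
  pdle p (submod_type (face_ideal (facets k))).
Proof.
move=> ep; apply: (face_ideal_tree (Q := fun I => pdle p (submod_type I))).
  by move=> i ik; apply: pdle_face_ideal1; have := eA ik; lia.
move=> I J j jk IJ pI pJ; apply: pdle_cap => //; rewrite IJ.
by apply: pdle_face_ideal1; have := esg jk; lia.
Qed.

End TreeIdeal.
(** * The Stanley-Reisner ring *)

Section StanleyReisnerRing.
Variables (K : fieldType) (n : nat) (F : simplicial_complex n).
Local Notation S := {mpoly K[n]}.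
Local Notation R := (SR_ring K F).
Local Notation proj := (@SR_proj K n F).
Local Notation IF := (face_ideal K (faces F)).
Implicit Types (p q : S) (m : 'X_{1..n}) (A B : {set 'I_n}).

Lemma covered_faces A : covered (faces F) A = (A \in faces F).
Proof.
apply/existsP/idP => [[B /andP[BF AB]]|AF]; first exact: face_sub BF AB.
by exists A; rewrite AF subxx.
Qed.

(** A monomial whose support is not a face is divisible by the squarefree monomial of that support,
    which is a generator. *)
Lemma SR_idealP p : (p \in @SR_ideal K n F) <-> IF p.
Proof.
split=> [/asboolP[c ->] m|pF]; last first.
  apply/asboolP; have [|c ->] := @monomial_ideal K n {set 'I_n}
      (fun A => A \notin faces F) (@mesym1 n) p.
    move=> m mp; exists (msup m).
      apply: contraL mp => mF; rewrite -mcoeff_eq0; apply/eqP/pF.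
      by rewrite covered_faces.
    by apply/mnm_lepP => i; rewrite mnmE inE; case: (m i).
  by exists c; apply: eq_bigr => A _; rewrite mesym1_prod.
rewrite covered_faces => mF; rewrite raddf_sum /= big1 // => A AF.
rewrite mesym1_prod; apply: mcoeffM_eq0 => m1 m2 mE; right.
rewrite mcoeffX; case: eqP => // m2E; case/negP: AF.
by apply: face_sub mF _; rewrite mE -m2E msupD msup_mesym1 subsetUr.
Qed.

Lemma SR_proj_zmod : zmod_morphism proj.
Proof. by move=> p q; rewrite /SR_proj rmorphB. Qed.

Lemma SR_proj_monoid : monoid_morphism proj.
Proof. by split; [apply: SR_proj1 | move=> p q; apply: SR_projM]. Qed.

HB.instance Definition _ := GRing.isZmodMorphism.Build S R proj SR_proj_zmod.
HB.instance Definition _ := GRing.isMonoidMorphism.Build S R proj SR_proj_monoid.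

Lemma SR_proj_eq p q : proj p = proj q <-> IF (p - q).
Proof.
rewrite -SR_idealP Quotient.idealrBE; split=> [E|/eqP //].
by apply/eqP.
Qed.

Lemma SR_proj_eq0 p : proj p = 0 <-> IF p.
Proof. by rewrite -(rmorph0 proj) SR_proj_eq subr0. Qed.

Lemma SR_proj_surj x : exists p, proj p = x.
Proof. by exists (repr x); rewrite /SR_proj reprK. Qed.

Lemma SR_proj_scale p q : p *: proj q = proj (p * q).
Proof. by rewrite rmorphM. Qed.

Lemma in_idealP (T : comNzRingType) (s : seq T) x :
  in_ideal s x <-> exists c : nat -> T, x = \sum_(i < size s) c i * s`_i.
Proof.
split=> [[c ->]|[c ->]]; last by exists (fun i => c i).
exists (fun i => oapp c 0 (insub i)); apply: eq_bigr => i _.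
by rewrite valK.
Qed.

Lemma in_ideal_proj (fs : seq S) g :
  in_ideal (map proj fs) (proj g) <-> foldl (@adjoin S) IF fs g.
Proof.
rewrite adjoinsP in_idealP size_map; split=> [[c cE]|[c]].
  have /choice [b bE] i : exists b, proj b = c i by apply: SR_proj_surj.
  exists b; apply/SR_proj_eq; rewrite cE rmorph_sum; apply: eq_bigr => i _.
  by rewrite (nth_map 0) // rmorphM /= bE.
move/SR_proj_eq => gE; exists (fun i => proj (c i)); rewrite gE rmorph_sum.
by apply: eq_bigr => i _; rewrite (nth_map 0) // rmorphM.
Qed.

Lemma SR_irrelevantP x : SR_irrelevant x <->
  exists b : 'I_n -> S, x = proj (\sum_i b i * 'X_i).
Proof.
rewrite /SR_irrelevant in_idealP size_map size_enum_ord.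
have nthE (i : 'I_n) : [seq proj 'X_i | i <- enum 'I_n]`_i = proj 'X_i.
  by rewrite (nth_map i) ?size_enum_ord // nth_ord_enum.
split=> [[c ->]|[b ->]].
  have /choice [b bE] i : exists b, proj b = c i by apply: SR_proj_surj.
  by exists (fun i => b i); rewrite rmorph_sum; apply: eq_bigr => i _; rewrite nthE rmorphM /= bE.
exists (fun i => proj (oapp b 0 (insub i))); rewrite rmorph_sum.
by apply: eq_bigr => i _; rewrite nthE rmorphM /= valK.
Qed.

Lemma SR_irrelevant_lift (s : seq R) : (forall x, x \in s -> SR_irrelevant x) ->
  exists fs : seq S, map proj fs = s /\
    forall f, f \in fs -> exists b : 'I_n -> S, f = \sum_i b i * 'X_i.
Proof.
elim: s => [|x s IHs] sJ; first by exists [::].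
have [|fs [fsE fsJ]] := IHs; first by move=> y ys; apply: sJ; rewrite inE ys orbT.
have /SR_irrelevantP[b ->] : SR_irrelevant x by apply: sJ; rewrite inE eqxx.
exists (\sum_i b i * 'X_i :: fs); rewrite /= fsE; split=> // f.
by rewrite inE => /orP[/eqP->|/fsJ //]; exists b.
Qed.

Lemma regular_sequence_wregular (fs : seq S) :
  (forall i, (i < size fs)%N -> forall x,
     in_ideal (take i (map proj fs)) ((map proj fs)`_i * x) ->
     in_ideal (take i (map proj fs)) x) <-> wregular IF fs.
Proof.
rewrite wregularP; split=> H i ifs => [g|x].
  have := H i ifs (proj g); rewrite (nth_map 0) // -rmorphM -map_take !in_ideal_proj.
  exact.
have [g <-] := SR_proj_surj x.
by rewrite (nth_map 0) // -rmorphM -map_take !in_ideal_proj; apply: H.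
Qed.

Lemma SR_irrelevant_mesym k : SR_irrelevant (proj (mesym n K k.+1)).
Proof.
have [|b bE] := @monomial_ideal K n 'I_n xpredT (fun i => U_(i)%MM) (mesym n K k.+1).
  move=> m; rewrite msupp_mesymP => /existsP[/= h /andP[/eqP hk /eqP ->]].
  have [i ih] : exists i, i \in h by apply/card_gt0P; rewrite hk.
  by exists i => //; rewrite lep1mP mnmE ih.
by apply/SR_irrelevantP; exists b; rewrite bE.
Qed.

(** Elements of the irrelevant ideal lift to polynomials without constant term, while constants
    survive in the quotient because the empty set is a face. *)
Lemma one_notin_irrelevant (s : seq R) :
  (forall x, x \in s -> SR_irrelevant x) -> ~ in_ideal s 1.
Proof.
move=> /SR_irrelevant_lift [fs [<- fsJ]].
rewrite -(rmorph1 proj) in_ideal_proj adjoinsP => -[c].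
move=> /(_ 0%MM); rewrite covered_faces msup0 face0 => /(_ isT) /eqP.
rewrite mcoeffB mcoeff1 eqxx raddf_sum big1 ?subr0 ?oner_eq0 //= => i _.
have [b ->] := fsJ _ (mem_nth 0 (ltn_ord i)).
rewrite mulr_sumr raddf_sum big1 //= => j _; rewrite mulrA.
apply: mcoeffM_eq0 => m1 m2 /esym/eqP; rewrite mnmD_eq0 => /andP[_ /eqP->]; right.
by rewrite mcoeffX mnm1_eq0.
Qed.

Lemma SR_depth_wregular e : wregular IF (mesyms K n e) ->
  (exists i, koszul_nonzero (fun i => 'X_i : S) IF i /\ n = (i + e)%N) -> SR_depth K F e.
Proof.
move=> eF [i [ki nE]]; split.
  have sJ x : x \in map proj (mesyms K n e) -> SR_irrelevant x.
    by move=> /mapP[f /mapP[j _ ->] ->]; apply: SR_irrelevant_mesym.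
  exists (map proj (mesyms K n e)); split=> //; first by rewrite size_map size_mkseq.
  split; first exact: one_notin_irrelevant.
  by rewrite size_map; apply/regular_sequence_wregular.
move=> s sJ [_ sreg]; have [fs [fsE fsJ]] := SR_irrelevant_lift sJ.
rewrite -fsE size_map in sreg *.
have /(wregular_size ki) : wregular IF fs by apply/regular_sequence_wregular.
by move=> /(_ fsJ) h; rewrite -(leq_add2l i) -nE.
Qed.

Lemma SR_depth_unique e e' : SR_depth K F e -> SR_depth K F e' -> e = e'.
Proof.
move=> [[s [<- sJ sr]] H] [[s' [<- sJ' sr']] H'].
by apply/eqP; rewrite eqn_leq H' // H.
Qed.

Lemma pdle_SR_ring (p : nat) : pdle p (submod_type IF) -> pdle p.+1 (R : lmodType S).
Proof.
move=> pF; have gL : linear (proj : S^o -> R).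
  by move=> a u v; rewrite rmorphD rmorphM.
exists (S^o : lmodType S), (submod_type IF), (submod_incl IF), (linear_of gL).
split=> //; first exact: projective_regular.
split; [exact: val_inj | exact: SR_proj_surj |].
move=> p'; rewrite SR_proj_eq0; split=> [pI|[z <-]]; last exact: submod_valP.
by exists (to_submod pI).
Qed.

Lemma kacyclic_mpoly : kacyclic (fun i => 'X_i : S) S^o.
Proof.
apply: kd_acyclic_regular => j s [a aE].
have [|b ->] := @monomial_ideal K n 'I_n (fun u => (j < u)%N) (fun u => U_(u)%MM) s;
  last by exists b.
move=> m ms; suff /existsP[u /andP[]] : [exists u : 'I_n, (j < u)%N && (U_(u) <= m)%MM].
  by exists u.
apply: contraLR ms => /existsPn mN.
(* The coefficient of m in s is that of m X_j in X_j s, a combination of variables X_u with u > j,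
   none of which divides m X_j. *)
rewrite -mcoeff_eq0 -(mcoeffMX s U_(j) m) mulrC aE raddf_sum big1 //= => u ju.
apply: mcoeffM_eq0 => m1 m2 mE; right; rewrite mcoeffX; case: eqP => // m2E.
have := mN u; rewrite ju /= lep1mP negbK => /eqP mu.
have := congr1 (fun m : 'X_{1..n} => m u) mE; rewrite !mnmDE mnm1E mu -m2E mnm1E eqxx.
by rewrite -val_eqE /= ltn_eqF //= addn0 => /eqP; rewrite eq_sym addn_eq0 andbF.
Qed.

Lemma pdle_koszul_SR i (p : nat) : koszul_nonzero (fun i => 'X_i : S) IF i ->
  pdle p (R : lmodType S) -> (i <= p)%N.
Proof.
move=> [c [c0 cI cw]] pR; rewrite leqNgt; apply/negP => pi; apply: cw.
have gL : linear (proj : S^o -> R) by move=> a u v; rewrite rmorphD rmorphM.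
have [||w wE] := pdle_koszul_vanish kacyclic_mpoly (c := fun A => proj (c A) : R) pR.
- by move=> A Ap; rewrite c0 ?rmorph0 //; apply: leq_ltn_trans pi.
- by move=> A; rewrite (kd_linear _ (linear_of gL)); apply/SR_proj_eq0.
have /choice [v vE] A : exists v : S^o, proj v = w A by apply: SR_proj_surj.
exists v => A; apply/SR_proj_eq; rewrite -wE.
rewrite -[RHS]/(linear_of gL _) -kd_linear.
by apply: eq_kd => B; rewrite /= vE.
Qed.

Lemma SR_projdim_koszul (p : nat) : pdle p.+1 (R : lmodType S) ->
  koszul_nonzero (fun i => 'X_i : S) IF p.+1 -> SR_projdim K F p.+1.
Proof.
move=> pR kp; split; first exact: pdle_resolution.
by move=> q /resolution_pdle; apply: pdle_koszul_SR.
Qed.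

End StanleyReisnerRing.

(** * Nonzero Koszul classes *)

Section KoszulCycle.
Variables (K : fieldType) (n : nat).
Local Notation S := {mpoly K[n]}.
Local Notation X := (fun i : 'I_n => 'X_i : S).
Implicit Types (A B U W : {set 'I_n}) (D : {set {set 'I_n}}).

(** The class of 1 in H_0, which is K. It serves for a single simplex, where the depth is n. *)
Lemma koszul_nonzero0 D : covered D set0 -> koszul_nonzero X (face_ideal K D) 0.
Proof.
move=> D0; exists (fun A => (A == set0)%:R); split=> // [A|].
  rewrite /kd big1 => [|u _]; first exact: submod0.
  case: eqP => [/setP/(_ u)|]; last by rewrite scaler0.
  by rewrite !inE eqxx.
case=> w /(_ set0 0%MM); rewrite msup0 => /(_ D0) /eqP.
rewrite eqxx mcoeffB mcoeff1 eqxx raddf_sum /= big1 ?subr0 ?oner_eq0 // => u _.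
apply: mcoeffM_eq0 => m1 m2 /esym/eqP; rewrite mnmD_eq0 => /andP[/eqP-> _]; left.
apply: mcoeffM_eq0 => m3 m4 /esym/eqP; rewrite mnmD_eq0 => /andP[_ /eqP->]; right.
by rewrite mcoeffX mnm1_eq0.
Qed.

(* If the restriction of the complex to W is disconnected, with U a union of
   components, then contracting e_W with the variables in U gives a cycle. It
   has the linear coefficients of a boundary only if the scalar coefficient of
   e_W is 1 (by the variables in U) and 0 (by the other ones). *)
Lemma koszul_nonzero_separated D U W a b : (forall i, covered D [set i]) ->
  U \subset W -> a \in U -> b \in W :\: U ->
  (forall u w, u \in U -> w \in W :\: U -> ~~ covered D [set u; w]) ->
  koszul_nonzero X (face_ideal K D) #|W|.-1.
Proof.
move=> D1 UW aU bWU sepU.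
pose E A : S^o := (A == W)%:R.
pose x1 u : S := if u \in U then 'X_u else 0.
pose x2 u : S := if u \in U then 0 else 'X_u.
exists (kd x1 E); split.
- move=> A AW; rewrite /kd big1 // => u uA; rewrite /E; case: eqP => [uAW|].
    by rewrite -uAW cardsU1 uA /= ltnn in AW.
  by rewrite scaler0.
(* The differential of [x1] squares to zero, so only that of [x2] acts on the chain. It yields
   multiples of X_u X_w with u in U and w in W outside U, which lie in the ideal. *)
- move=> A; have -> : kd X (kd x1 E) A = kd (fun u => x1 u + x2 u) (kd x1 E) A.
    apply: eq_bigr => u _; congr (_ * _ *: _); rewrite /x1 /x2.
    by case: ifP; rewrite ?addr0 ?add0r.
  rewrite kd_add kd_kd add0r /kd; apply: submod_sum => w wA.
  rewrite scaler_sumr; apply: submod_sum => u; rewrite !inE negb_or => /andP[uw uA].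
  rewrite scalerA /E; case: eqP => [AW|_]; last first.
    rewrite scaler0.
    exact: submod0.
  rewrite /x1 /x2; case: ifP => wU; first by rewrite mulr0 mul0r scale0r; apply: submod0.
  case: ifP => uU; last by rewrite !mulr0 scale0r; apply: submod0.
  have wW : w \in W :\: U by rewrite inE wU -AW !inE eqxx orbT.
  move=> m mD; rewrite -[_ *: _]/(_ * _) mulr1 mulrACA mulrC.
  apply: mcoeffM_eq0 => m1 m2 mE; left; rewrite -mpolyXD mcoeffX.
  case: eqP => // m1E; case/negP: (sepU u w uU wW); apply: coveredS mD.
  by rewrite mE -m1E !msupD !msup1 [_ :|: [set u]]setUC subsetUl.
case=> v vE.
(* Coefficients of X_z at [W :\ z] are compared: in the boundary only the term indexed by z
   contributes, with the same sign as in the chain. *)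
have key z : z \in W -> (z \in U)%:R = (v W)@_0%MM.
  move=> zW; have := vE (W :\ z) U_(z)%MM; rewrite msup1 => /(_ (D1 z)).
  have zD : z \notin W :\ z by rewrite !inE eqxx.
  have lin0 u (q s : S) : u != z -> (s * 'X_u * q)@_U_(z) = 0.
    move=> uz; apply: mcoeffM_eq0 => m1 m2 mE; left; apply: mcoeffM_eq0 => m3 m4 m1E.
    right; rewrite mcoeffX; case: eqP => // m4E.
    have := congr1 (fun m : 'X_{1..n} => m u) mE.
    rewrite m1E !mnmDE -m4E !mnm1E eqxx eq_sym (negPf uz); lia.
  rewrite mcoeffB /kd !(bigD1 z zD) /= !mcoeffD !raddf_sum /= big1 => [|u /andP[_ uz]].
    rewrite big1 => [|u /andP[_ uz]]; last exact: lin0.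
    rewrite !addr0 setD1K // /E eqxx /x1.
    set s := ksign _ _ _.
    have lin (q : S) : ((s * 'X_z) *: (q : S^o))@_U_(z) = s@_0 * q@_0.
      rewrite -[_ *: _]/(_ * _) mulrAC -[X in _@_X]addm0 mcoeffMX.
      exact: (rmorphM (mcoeff 0%MM)).
    have s0 : s@_0 != 0.
      apply: contra_eq_neq (congr1 (mcoeff 0%MM) (ksign_sqr S z (W :\ z))) => s0.
      by rewrite (rmorphM (mcoeff 0%MM)) /= s0 mul0r mcoeff1 eqxx eq_sym oner_eq0.
    rewrite lin; case: ifP => zU; rewrite ?lin ?mulr0 ?scale0r ?mcoeff0.
      rewrite mcoeff1 eqxx -mulrBr => /eqP; rewrite mulf_eq0 (negPf s0) subr_eq0.
      by move/eqP.
    by rewrite sub0r => /eqP; rewrite oppr_eq0 mulf_eq0 (negPf s0) => /eqP.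
  rewrite /x1; case: ifP => _; first exact: lin0.
  by rewrite mulr0 scale0r mcoeff0.
have := key a (subsetP UW a aU); move: bWU; rewrite inE => /andP[bU /key].
by rewrite aU (negPf bU) => <- /eqP; rewrite oner_eq0.
Qed.

Variables (A sg : nat -> {set 'I_n}) (k : nat).
Hypothesis tA : tree_data A sg k.
Hypothesis irrA : forall i j, (i < k)%N -> (j < k)%N -> A i \subset A j -> i = j.

(** U collects, outside s_j, the vertices of the facets attached on the side of A_j. By irredundancy
    neither A_j nor A_0 lies in s_j, which provides a and b. *)
Lemma tree_separation j : (0 < j < k)%N -> exists U a b,
  [/\ U \subset ~: sg j, a \in U, b \in ~: sg j :\: U &
      forall u w, u \in U -> w \in ~: sg j :\: U ->
        ~~ covered (facets A k) [set u; w]].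
Proof.
move=> /[dup] jk /andP[j0 jk']; set W := sg j.
have [[i0 i0j Wi0] WAj WP] := tA jk.
have i0k : (i0 < k)%N := ltn_trans i0j jk'.
have k0 : (0 < k)%N := leq_ltn_trans (leq0n j) jk'.
(* The invariant after the facets up to l: outside s_j each of them lies in U, or it is disjoint
   from U, and A_0 is of the second kind. *)
suff H l : (j <= l < k)%N -> exists U : {set 'I_n},
    [/\ A j :\: W \subset U, [disjoint U & W],
        forall u, u \in U -> exists2 i, (i <= l)%N & u \in A i,
        [disjoint A 0%N & U] &
        forall i, (i <= l)%N -> (A i :\: W \subset U) \/ [disjoint A i & U]].
  have [|U [AjU UW _ A0U AU]] := H k.-1; first by lia.
  have [a] : exists a, a \in A j :\: W.
    apply/set0Pn; rewrite setD_eq0; apply: contraTN i0j => AW.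
    rewrite (irrA (i := j) (j := i0)) ?ltnn //.
    exact: subset_trans AW Wi0.
  move=> aj; have [b] : exists b, b \in A 0%N :\: W.
    apply/set0Pn; rewrite setD_eq0; apply: contraTN j0 => AW.
    rewrite -(irrA (i := 0) (j := j)) ?ltnn //.
    exact: subset_trans AW WAj.
  rewrite inE => /andP[bW b0].
  exists U, a, b; split.
  - by rewrite -disjoints_subset.
  - exact: (subsetP AjU).
  - by rewrite !inE bW andbT (disjointFr A0U b0).
  - move=> u w uU; rewrite !inE => /andP[wU wW]; apply/coveredP => -[i ik].
    rewrite subUset !sub1set => /andP[ui wi].
    have [|AiU|AiU] := AU i; first by rewrite -ltnS prednK.
      by case/negP: wU; apply: (subsetP AiU); rewrite inE wW.
    by rewrite (disjointFr AiU ui) in uU.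
elim: l => [|l IHl] jl; first by lia.
have [jl'|lj] := leqP j l; last first.
  have <- : j = l.+1 by lia.
  exists (A j :\: W); split=> //.
  - by rewrite disjoints_subset; apply/subsetP=> u; rewrite !inE => /andP[].
  - by move=> u; rewrite inE => /andP[_ uj]; exists j.
  - rewrite disjoint_sym disjoints_subset; apply/subsetP=> u; rewrite !inE => /andP[uW uj].
    by apply: contra uW => u0; apply: (subsetP (WP 0%N _)) => //; rewrite inE u0.
  - move=> i; rewrite leq_eqVlt => /orP[/eqP->|ij]; first by left.
    right; rewrite disjoint_sym disjoints_subset; apply/subsetP=> u.
    rewrite !inE => /andP[uW uj].
    by apply: contra uW => ui; apply: (subsetP (WP i _)) => //; rewrite inE ui.
have [|U [AjU UW Ul A0U AU]] := IHl; first by lia.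
have [|[i il si] sl sP] := tA (j := l.+1); first by lia.
(* The new facet hangs on [A i] through [sg l.+1] and joins the side on which [A i] lies. *)
have [AiU|AiU] := AU i il.
  have newU u i' : (i' <= l)%N -> [disjoint A i' & U] -> u \in A i' -> u \in A l.+1 ->
      u \notin W -> False.
    move=> i'l Ai'U ui' ul uW; have uU : u \in U.
      apply: (subsetP AiU); rewrite inE uW (subsetP si) //.
      by apply: (subsetP (sP i' _)) => //; rewrite inE ui'.
    by rewrite (disjointFr Ai'U ui') in uU.
  have disjU i' : (i' <= l)%N -> [disjoint A i' & U] -> [disjoint A i' & U :|: (A l.+1 :\: W)].
    move=> i'l Ai'U; rewrite disjoints_subset; apply/subsetP=> u ui'.
    rewrite !inE negb_or (disjointFr Ai'U ui') /=; apply/negP => /andP[uW ul].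
    exact: newU ui' ul uW.
  exists (U :|: (A l.+1 :\: W)); split.
  - exact: subset_trans AjU (subsetUl _ _).
  - rewrite disjoints_subset; apply/subsetP=> u; rewrite !inE => /orP[uU|/andP[]//].
    by rewrite (disjointFr UW uU).
  - move=> u; rewrite !inE => /orP[/Ul[i' i'l ui']|/andP[_ ul]]; last by exists l.+1.
    by exists i' => //; apply: leqW.
  - exact: disjU.
  - move=> i'; rewrite leq_eqVlt => /orP[/eqP->|i'l]; first by left; apply: subsetUr.
    have [Ai'U|Ai'U] := AU i' i'l; last by right; apply: disjU.
    by left; apply: subset_trans Ai'U (subsetUl _ _).
exists U; split=> // [u /Ul[h hl uh]|h]; first by exists h => //; apply: leqW.
rewrite leq_eqVlt => /orP[/eqP->|/AU //]; right.
rewrite disjoints_subset; apply/subsetP=> u ul; rewrite inE; apply/negP => uU.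
have [i' i'l ui'] := Ul u uU.
have : u \in A i by apply/(subsetP si)/(subsetP (sP i' i'l)); rewrite inE ui'.
by move/(disjointFr AiU); rewrite uU.
Qed.

End KoszulCycle.
(** * Krull dimension *)

Section AlgebraicDependence.
Variables (K : fieldType) (n : nat).
Local Notation S := {mpoly K[n]}.
Implicit Types (B : {set 'I_n}) (p q : S).

(** Setting the variables outside B to 0 realizes S/I(B) as a polynomial subring of S, hence as a
    domain. *)
Definition restr B : S -> S :=
  comp_mpoly [tuple if i \in B then 'X_i else 0 | i < n].

HB.instance Definition _ B := GRing.RMorphism.on (restr B).

Lemma restrE B p : restr B p = mfilter (fun m => msup m \subset B) p.
Proof.
rewrite /restr comp_mpolyEX /mfilter [RHS]big_mkcond; apply: eq_bigr => m _.
rewrite comp_mpolyX; case: ifP => [mB|/negbT /subsetPn[i im iB]]; last first.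
  rewrite (bigD1 i) //= tnth_mktuple (negPf iB) expr0n.
  by rewrite inE in im; rewrite (negPf im) mul0r scaler0.
rewrite mpolyXE_id; congr (_ *: _); apply: eq_bigr => i _; rewrite tnth_mktuple.
have [->|mi] := eqVneq (m i) 0%N; first by rewrite !expr0.
by rewrite (subsetP mB) // inE.
Qed.

Lemma restr_eq0 B p : restr B p = 0 <-> face_ideal K [set B] p.
Proof.
rewrite restrE; split=> [/mpolyP pB m|pB].
  by rewrite covered1 => mB; have := pB m; rewrite mcoeff_mfilter mB mcoeff0.
apply/mpolyP => m; rewrite mcoeff_mfilter mcoeff0; case: ifP => // mB.
by rewrite pB // covered1.
Qed.

Lemma restr_id B p : restr B (restr B p) = restr B p.
Proof.
by apply/mpolyP => m; rewrite !restrE !mcoeff_mfilter; case: (_ \subset _).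
Qed.

Lemma restrZ B c p : restr B (c *: p) = c *: restr B p.
Proof. by rewrite -!mul_mpolyC rmorphM /= /restr comp_mpolyC. Qed.

Lemma msize_prod_exp e D (f : 'I_e -> S) (a : 'I_e -> nat) :
  (forall i, (msize (f i) <= D.+1)%N) ->
  (msize (\prod_i f i ^+ a i) <= (\sum_i a i * D).+1)%N.
Proof.
move=> fD; have le p q d d' : (msize p <= d.+1)%N -> (msize q <= d'.+1)%N ->
    (msize (p * q) <= (d + d').+1)%N.
  move=> pd qd'; have [->|p0] := eqVneq p 0; first by rewrite mul0r msize0.
  have [->|q0] := eqVneq q 0; first by rewrite mulr0 msize0.
  by move: pd qd'; rewrite msizeM //; move: (msize p) (msize q) => u v; lia.
apply: (big_ind2 (fun p d => (msize p <= d.+1)%N)) => [|p d q d'|i _].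
- by rewrite msize1.
- exact: le.
- elim: (a i) => [|b IHb]; first by rewrite expr0 msize1.
  by rewrite exprS mulSn; apply: le.
Qed.

(* The monomials in the f_i of partial degrees less than N outnumber the
   monomials in the variables of B that can occur in them. *)
Lemma algebraic_dependence e B (f : 'I_e -> S) : (#|B| < e)%N ->
  (forall i, restr B (f i) = f i) ->
  exists2 Q : {mpoly K[e]}, Q != 0 & Q \mPo [tuple f i | i < e] = 0.
Proof.
move=> Be fB; pose D := \max_i msize (f i).
have fD i : (msize (f i) <= D.+1)%N.
  by apply: leqW; apply: (leq_bigmax (F := fun i => msize (f i))).
(* Products of powers of the f_i with exponents below N have degree less than L. Since L <= N C and
   C^|B| < N, the L^|B| candidate monomials are fewer than N^(|B|+1) <= N^e products, which forces a
   linear relation. *)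
pose C := (e * D).+1; pose N := (C ^ #|B|).+1; pose L := (e * (N * D)).+1.
pose T1 := {ffun 'I_e -> 'I_N}; pose T2 := {ffun {i : 'I_n | i \in B} -> 'I_L}.
have card12 : (#|T2| < #|T1|)%N.
  rewrite !card_ffun !card_ord card_sig.
  have -> : #|[pred i | i \in B]| = #|B| by apply: eq_card.
  have LN : (L <= N * C)%N by rewrite /L /C; nia.
  apply: (@leq_ltn_trans ((N * C) ^ #|B|)).
    by case: #|B| LN => // b LN; rewrite leq_exp2r.
  apply: (@leq_trans (N ^ #|B|.+1)); last by rewrite leq_pexp2l.
  by rewrite expnMn expnS mulnC ltn_pmul2r ?expn_gt0.
pose mon (al : T1) : S := \prod_i f i ^+ al i.
pose ext (be : T2) : 'X_{1..n} := [multinom oapp (fun u => val (be u)) 0%N (insub i) | i < n].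
pose M : 'M[K]_(#|T1|, #|T2|) := \matrix_(i, j) (mon (enum_val i))@_(ext (enum_val j)).
have [la la0 laM] : exists2 la : 'rV[K]_#|T1|, la != 0 & la *m M = 0.
  have : kermx M != 0.
    rewrite -mxrank_eq0 mxrank_ker subn_eq0 -ltnNge.
    by apply: leq_ltn_trans (rank_leq_col M) card12.
  case/rowV0Pn => la /sub_kermxP laM la0.
  by exists la.
pose mm (al : T1) : 'X_{1..e} := [multinom val (al i) | i < e].
have mmI : injective mm.
  move=> al al' /mnmP E; apply/ffunP => i; apply: val_inj.
  by have := E i; rewrite !mnmE.
exists (\sum_i la 0 i *: 'X_[mm (enum_val i)]).
  have [i lai] : exists i, la 0 i != 0.
    by apply/existsP; apply: contra_neqT la0 => /existsPn la0; apply/rowP => i;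
       rewrite mxE; apply/eqP/negbNE/la0.
  apply: contra_neq lai => /(congr1 (mcoeff (mm (enum_val i)))).
  rewrite raddf_sum mcoeff0 (bigD1 i) //= mcoeffZ mcoeffX eqxx mulr1 big1 ?addr0 // => j ji.
  rewrite mcoeffZ mcoeffX; case: eqP => [/mmI/enum_val_inj E|]; last by rewrite mulr0.
  by rewrite E eqxx in ji.
rewrite raddf_sum /=.
have monE i : (la 0 i *: 'X_[mm (enum_val i)]) \mPo [tuple f i | i < e]
    = la 0 i *: mon (enum_val i).
  rewrite comp_mpolyZ comp_mpolyX; congr (_ *: _); apply: eq_bigr => j _.
  by rewrite tnth_mktuple mnmE.
under eq_bigr do rewrite monE.
apply/mpolyP => m; rewrite mcoeff0 raddf_sum /=.
have [/andP[mB mL]|mBL] := boolP ((msup m \subset B) && (mdeg m < L)%N); last first.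
  rewrite big1 // => i _; rewrite mcoeffZ; apply/eqP; rewrite mulf_eq0; apply/orP; right.
  rewrite mcoeff_eq0; apply: contra mBL => mi; apply/andP; split.
    have monB : restr B (mon (enum_val i)) = mon (enum_val i).
      by rewrite rmorph_prod; apply: eq_bigr => j _; rewrite rmorphXn /= fB.
    by move: mi; rewrite -monB restrE mcoeff_msupp mcoeff_mfilter; case: ifP; rewrite ?eqxx.
  apply: leq_trans (msize_mdeg_lt mi) _; apply: leq_trans (msize_prod_exp _ fD) _.
  rewrite ltnS; apply: (@leq_trans (\sum_(j < e) N * D)); last by rewrite sum_nat_const card_ord.
  by apply: leq_sum => j _; rewrite leq_mul2r ltnW ?orbT.
have mLi i : (m i < L)%N.
  by apply: leq_ltn_trans mL; rewrite mdegE (bigD1 i) //= leq_addr.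
pose be : T2 := [ffun u => Ordinal (mLi (val u))].
have mE : ext be = m.
  apply/mnmP => i; rewrite mnmE; case: insubP => [u iB uE|iB] /=.
    by rewrite ffunE /= uE.
  apply/esym/eqP; apply: contraNT iB => mi.
  by apply: (subsetP mB); rewrite inE.
transitivity ((la *m M) 0 (enum_rank be)); last by rewrite laM mxE.
by rewrite mxE; apply: eq_bigr => i _; rewrite mxE enum_rankK mE mcoeffZ.
Qed.

End AlgebraicDependence.

(** * Elements chosen along a prime chain *)

Section PrimeChains.
Variables (K : fieldType) (n : nat).
Local Notation S := {mpoly K[n]}.

(* In a relation Q(a) in P_0, dividing by a_j modulo P_j, for j = 0, 1, ..., and
   passing to P_{j+1} leaves only the monomials with the smallest exponent of a_j;
   in the end the coefficient of a single monomial would lie in P_e. *)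
Lemma prime_chain_independent e (P : nat -> {pred S}) (a : nat -> S)
    (Q : {mpoly K[e]}) :
  (forall j p q, p \in P j -> q \in P j -> p - q \in P j) ->
  (forall j p q, q \in P j -> p * q \in P j) ->
  (forall j, 1 \notin P j) ->
  (forall j p q, p * q \in P j -> p \notin P j -> q \in P j) ->
  (forall j, (j < e)%N -> {subset P j <= P j.+1}) ->
  (forall j, (j < e)%N -> a j \in P j.+1 /\ a j \notin P j) ->
  Q != 0 -> Q \mPo [tuple a i | i < e] \notin P 0%N.
Proof.
move=> PB PM P1 Pprime Pinc Pa Q0.
pose mon j (m : 'X_{1..e}) : S := \prod_(i < e | (j <= i)%N) a i ^+ m i.
(* The d variables from j on remain. The monomials of M agree in the earlier exponents, so [mon j]
   keeps them distinct with those factors divided out. *)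
suff H d j (M : seq 'X_{1..e}) : (j + d = e)%N -> uniq M -> M != [::] ->
    {subset M <= msupp Q} ->
    (forall (m m' : 'X_{1..e}) (i : 'I_e), m \in M -> m' \in M -> (i < j)%N -> m i = m' i) ->
    \sum_(m <- M) Q@_m *: mon j m \notin P j.
  rewrite comp_mpolyEX.
  have -> : \sum_(m <- msupp Q) Q@_m *: ('X_[m] \mPo [tuple a i | i < e])
      = \sum_(m <- msupp Q) Q@_m *: mon 0%N m.
    apply: eq_bigr => m _; rewrite comp_mpolyX; congr (_ *: _).
    by apply: eq_bigr => i _; rewrite tnth_mktuple.
  by apply: (H e) => //; rewrite ?msupp_uniq ?msupp_eq0.
elim: d j M => [|d IHd] j M jd Mu M0 MQ Mj.
  case: M M0 Mu MQ Mj => // m [|m' M] _ Mu MQ Mj.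
    rewrite big_seq1 /mon big1 => [|i ij]; last by have := ltn_ord i; lia.
    have Qm : Q@_m != 0 by rewrite -mcoeff_msupp MQ // inE.
    apply: contra (P1 j) => /(PM _ (Q@_m)^-1%:MP).
    by rewrite mul_mpolyC scalerA mulVf // scale1r.
  move: Mu; rewrite /= inE negb_or => /andP[/andP[/eqP mm' _] _]; case: mm'.
  by apply/mnmP => i; apply: Mj; rewrite ?inE ?eqxx ?orbT //; have := ltn_ord i; lia.
have je : (j < e)%N by lia.
pose oj := Ordinal je; have [aj1 aj] := Pa j je.
have [t tM tmin] : exists2 t : 'X_{1..e}, t \in M &
    forall m : 'X_{1..e}, m \in M -> (t oj <= m oj)%N.
  have ex : exists v, v \in [seq (m : 'X_{1..e}) oj | m <- M].
    case: M M0 {Mu MQ Mj} => // m M _; exists (m oj); exact: mem_head.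
  case: (ex_minnP ex) => v /mapP[t tM ->] vmin; exists t => // m mM.
  by apply: vmin; apply/mapP; exists m.
pose M' := [seq m : 'X_{1..e} <- M | m oj == t oj].
have monS m : mon j m = a j ^+ m oj * mon j.+1 m.
  rewrite /mon (bigD1 oj) //=; congr (_ * _); apply: eq_bigl => i.
  by rewrite -val_eqE /=; lia.
pose rest := \sum_(m <- M | (m : 'X_{1..e}) oj != t oj)
  Q@_m *: (a j ^+ (m oj - t oj).-1 * mon j.+1 m).
have sumE : \sum_(m <- M) Q@_m *: mon j m
    = a j ^+ t oj * (\sum_(m <- M') Q@_m *: mon j.+1 m + rest * a j).
  rewrite mulrDr /rest mulr_suml !mulr_sumr (bigID (fun m : 'X_{1..e} => m oj == t oj)) /=.
  rewrite big_filter; congr (_ + _).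
    by apply: eq_bigr => m /eqP mt; rewrite monS mt -scalerAr.
  rewrite big_seq_cond [RHS]big_seq_cond; apply: eq_bigr => m /andP[mM mt].
  rewrite -scalerAl -scalerAr monS; congr (_ *: _).
  have E : m oj = (t oj + ((m oj - t oj).-1 + 1))%N by have := tmin m mM; lia.
  by rewrite [in LHS]E !exprD expr1; ring.
rewrite sumE; apply/negP => /Pprime H.
have {}H : \sum_(m <- M') Q@_m *: mon j.+1 m + rest * a j \in P j.
  apply: H; elim: (t oj) => [|b IHb]; first by rewrite expr0 P1.
  by rewrite exprS; apply: contra IHb => /Pprime; apply.
suff : \sum_(m <- M') Q@_m *: mon j.+1 m \in P j.+1.
  apply/negP; apply: IHd; first by lia.
  - by rewrite filter_uniq.
  - by rewrite -has_filter; apply/hasP; exists t.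
  - by move=> m; rewrite mem_filter => /andP[_ /MQ].
  - move=> m m' i; rewrite !mem_filter => /andP[/eqP mt mM] /andP[/eqP mt' mM'].
    rewrite ltnS leq_eqVlt => /orP[/eqP ij|]; last exact: Mj.
    by rewrite (_ : i = oj) ?mt ?mt' //; apply: val_inj.
rewrite -[X in X \in _](addrK (rest * a j)); apply: PB; last exact: PM.
exact: Pinc H.
Qed.

End PrimeChains.

(** * Krull dimension of the Stanley-Reisner ring *)

Section StanleyReisnerDimension.
Variables (K : fieldType) (n : nat) (F : simplicial_complex n).
Local Notation S := {mpoly K[n]}.
Local Notation R := (SR_ring K F).
Local Notation proj := (@SR_proj K n F).
Local Notation IF := (face_ideal K (faces F)).
Implicit Types (p q : S) (A B : {set 'I_n}).

(** The image of I(B), tested on a representative; for a face B the choice is immaterial, as I(F) is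
    contained in I(B). *)
Definition face_prime_pred B : {pred R} := fun x => `[< face_ideal K [set B] (repr x) >].

Lemma face_prime_pred_proj B p : B \in faces F ->
  (proj p \in face_prime_pred B) <-> face_ideal K [set B] p.
Proof.
move=> BF; have dI : face_ideal K [set B] (repr (proj p) - p).
  have /SR_proj_eq pI : proj (repr (proj p)) = proj p by rewrite /SR_proj reprK.
  by move=> m mB; apply: pI; apply: coveredS (_ : covered _ B);
     rewrite ?covered_faces // -covered1.
split=> [/asboolP H|H]; last apply/asboolP.
  by rewrite -[p](subKr (repr (proj p))); apply: submodB.
by rewrite -[repr _](subrK p); apply: submodD.
Qed.

Lemma face_prime_closed B : B \in faces F -> idealr_closed (face_prime_pred B).
Proof.
move=> BF; split.
- by rewrite -(rmorph0 proj); apply/face_prime_pred_proj => //; apply: submod0.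
- apply/negP; rewrite -(rmorph1 proj) => /(face_prime_pred_proj _ BF) /(_ 0%MM).
  rewrite covered1 msup0 sub0set mcoeff1 eqxx => /(_ isT) /eqP.
  by rewrite oner_eq0.
- move=> a x y; have [[[p <-] [q <-]] [r <-]] :=
    (SR_proj_surj a, SR_proj_surj x, SR_proj_surj y).
  rewrite -rmorphM -rmorphD !face_prime_pred_proj => // qB rB.
  by apply: submodD => //; apply: submod_mull.
Qed.

Lemma face_prime_prime B : B \in faces F -> prime_idealr_closed (face_prime_pred B).
Proof.
move=> BF x y; have [[p <-] [q <-]] := (SR_proj_surj x, SR_proj_surj y).
rewrite -rmorphM face_prime_pred_proj // -restr_eq0 rmorphM => /eqP.
by rewrite mulf_eq0 => /orP[]/eqP/restr_eq0 H; apply/orP; [left|right];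
  apply/face_prime_pred_proj.
Qed.

Definition face_prime B (BF : B \in faces F) : prime_idealr R :=
  HB.pack (face_prime_pred B)
    (isIdealr.Build R (face_prime_pred B) (face_prime_closed BF))
    (isPrimeIdealrClosed.Build R (face_prime_pred B) (face_prime_prime BF)).

Lemma face_primeP B (BF : B \in faces F) p :
  (proj p \in face_prime BF) <-> face_ideal K [set B] p.
Proof. exact: face_prime_pred_proj. Qed.

Lemma face_ideal_X B i : face_ideal K [set B] ('X_i : S) <-> i \notin B.
Proof.
split=> [/(_ U_(i)%MM)|iB m].
  rewrite covered1 msup1 sub1set mcoeffX eqxx; apply: contraPN => iB /(_ iB) /eqP.
  by rewrite oner_eq0.
rewrite covered1 mcoeffX; case: eqP => // <-.
by rewrite msup1 sub1set (negPf iB).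
Qed.

(** The primes generated by the variables outside a face grow as the face loses its vertices one by
    one, down to the empty face. *)
Lemma SR_prime_chain A : A \in faces F -> prime_chain R #|A|.
Proof.
move=> AF; pose B i := [set x in drop i (enum A)].
have BF i : B i \in faces F.
  apply: face_sub AF _; apply/subsetP => x; rewrite inE => /mem_drop.
  by rewrite mem_enum.
exists (fun i => face_prime (BF i)) => i iA.
have [x xE] : exists x, drop i (enum A) = x :: drop i.+1 (enum A).
  have [x0 _] : exists x, x \in A by apply/card_gt0P; apply: leq_ltn_trans iA.
  by exists (nth x0 (enum A) i); rewrite -drop_nth // -cardE.
have xB : x \notin B i.+1.
  have := drop_uniq i (enum_uniq A); rewrite xE /= => /andP[xN _].
  by rewrite inE.
split=> [y|].
  have [p <-] := SR_proj_surj y; rewrite !face_primeP => pB m.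
  rewrite covered1 => mB; apply: pB; rewrite covered1; apply: subset_trans mB _.
  by apply/subsetP => z; rewrite !inE xE inE orbC => ->.
exists (proj 'X_x); first by apply/face_primeP/face_ideal_X.
apply/negP => /face_primeP/face_ideal_X/negP; apply.
by rewrite inE xE inE eqxx.
Qed.

(** If all faces had fewer than e vertices, elements a_i of P_{i+1} outside P_i would satisfy a
    relation on each face. The product of these relations holds on all of F, hence in P_0, against
    [prime_chain_independent]. *)
Lemma prime_chain_face e : prime_chain R e -> exists2 A, A \in faces F & (e <= #|A|)%N.
Proof.
move=> [P Pinc]; apply/exists_inP; apply: contraT => /exists_inPn Fe; exfalso.
have /choice [a aP] : forall i, exists a : S, (i < e)%N ->
    proj a \in P i.+1 /\ proj a \notin P i.
  move=> i; case: (ltnP i e) => ie; last by exists 0.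
  have [_ [x xP xN]] := Pinc i ie; have [a aE] := SR_proj_surj x.
  by exists a; rewrite aE.
have /choice [Q QP] : forall A, exists Q : {mpoly K[e]}, Q != 0 /\
    (A \in faces F -> Q \mPo [tuple restr A (a i) | i < e] = 0).
  (* Nonfaces receive the polynomial 1, neutral in the product below. *)
  move=> A; case: (boolP (A \in faces F)) => AF; last by exists 1; rewrite oner_neq0.
  have [||Q Q0 QA] := @algebraic_dependence K n e A (fun i => restr A (a i)).
  - by rewrite ltnNge; apply: Fe.
  - by move=> i; apply: restr_id.
  by exists Q.
pose q := \prod_A Q A.
have : q \mPo [tuple a i | i < e] \notin [pred p | proj p \in P 0%N].
  apply: (prime_chain_independent (P := fun j => [pred p | proj p \in P j])).
  - by move=> j p p'; rewrite !inE rmorphB; apply: rpredB.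
  - by move=> j p p'; rewrite !inE rmorphM; apply: idealMr.
  - by move=> j; rewrite inE rmorph1 idealr1.
  - move=> j p p'; rewrite !inE rmorphM prime_idealrM => /orP[->//|//].
  - by move=> j /Pinc[jP _] p; rewrite !inE; apply: jP.
  - by move=> j je; rewrite !inE; apply: aP.
  - by apply/prodf_neq0 => A _; have [] := QP A.
rewrite inE (_ : proj _ = 0) ?idealr0 //; apply/SR_proj_eq0 => m mF.
rewrite covered_faces in mF.
have : face_ideal K [set msup m] (q \mPo [tuple a i | i < e]).
  apply/restr_eq0; rewrite /q (bigD1 (msup m)) //= rmorphM /= rmorphM /=.
  have [_ /(_ mF) E] := QP (msup m); rewrite -[RHS](mul0r (restr (msup m)
    ((\prod_(i | i != msup m) Q i) \mPo [tuple a i | i < e]))) -E; congr (_ * _).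
  rewrite !comp_mpolyEX rmorph_sum; apply: eq_bigr => m' _.
  rewrite /= restrZ; congr (_ *: _); rewrite !comp_mpolyX rmorph_prod.
  by apply: eq_bigr => i _; rewrite rmorphXn /= !tnth_mktuple.
by apply; rewrite covered1.
Qed.

End StanleyReisnerDimension.
(** * Hilbert series *)

Lemma fps_inv_unique (p : {poly int}) (f : nat -> int) : p`_0 = 1 ->
  (forall j, \sum_(i < j.+1) p`_i * f (j - i)%N = (j == 0%N)%:R) -> fps_inv p =1 f.
Proof.
move=> p0 fE; elim/ltn_ind => j IHj.
have := fE j; rewrite -(fps_invP p0 j) !big_ord_recl !subn0 p0 !mul1r => /esym.
rewrite [X in _ + X = _](eq_bigr (fun i : 'I_j =>
  p`_(fintype.lift ord0 i) * f (j - fintype.lift ord0 i)%N)).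
  exact: addIr.
by move=> i _; rewrite IHj // lift0; have := ltn_ord i; lia.
Qed.

Lemma coef0_one_minus_X_pow a : ((1 - 'X) ^+ a : {poly int})`_0 = 1.
Proof. by rewrite -horner_coef0 horner_exp !hornerE expr1n. Qed.

Lemma inv_one_minus_t_pow0 j : inv_one_minus_t_pow 0 j = (j == 0%N)%:R.
Proof.
apply: (fps_inv_unique (f := fun j => (j == 0%N)%:R)) => [|{}j].
  exact: coef0_one_minus_X_pow.
by rewrite big_ord_recl coef1 subn0 mul1r big1 ?addr0 // => i _; rewrite coef1 mul0r.
Qed.

Lemma inv_one_minus_t_pow_coef0 a : inv_one_minus_t_pow a 0 = 1.
Proof.
have := fps_invP (coef0_one_minus_X_pow a) 0.
by rewrite big_ord1 coef0_one_minus_X_pow mul1r.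
Qed.

(** The identity (1 - t)^(-a) = (1 - t) (1 - t)^(-a-1), read on coefficients. In the proof [f] is
    the series (1 - t) g, and [G] truncates g to a polynomial. *)
Lemma inv_one_minus_t_powS a j : inv_one_minus_t_pow a.+1 j.+1 =
  inv_one_minus_t_pow a.+1 j + inv_one_minus_t_pow a j.+1.
Proof.
pose g := inv_one_minus_t_pow a.+1; pose f j := g j - if j is j'.+1 then g j' else 0.
suff fE : inv_one_minus_t_pow a =1 f by rewrite [X in _ + X]fE /f addrC subrK.
apply: fps_inv_unique; first exact: coef0_one_minus_X_pow.
move=> i; pose G : {poly int} := \poly_(l < i.+1) g l.
rewrite -(fps_invP (coef0_one_minus_X_pow a.+1)).
transitivity (((1 - 'X) ^+ a * ((1 - 'X) * G))`_i).
  rewrite coefM; apply: eq_bigr => l _; congr (_ * _).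
  rewrite mulrBl mul1r coefB coefXM !coef_poly /f.
  by case: (i - l)%N (leq_subr l i) => [|m] mi; rewrite ltnS mi //= ltnW.
rewrite mulrA -exprSr coefM; apply: eq_bigr => l _; congr (_ * _).
by rewrite coef_poly ltnS leq_subr.
Qed.

Section MonomialCount.
Variable n : nat.
Implicit Types (A B : {set 'I_n}).

Definition mcount (Q : pred {set 'I_n}) j : int :=
  #|[pred m : 'X_{1..n < j.+1} | (mdeg m == j) && Q (msup m)]|%:Z.

Lemma mcountE Q j :
  mcount Q j = \sum_(m : 'X_{1..n < j.+1} | mdeg m == j) (Q (msup m))%:R.
Proof.
rewrite /mcount -natr_sum natz -sum1_card; congr Posz; rewrite [LHS]big_mkcondr /=.
by apply: eq_bigr => m _; case: (Q _).
Qed.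

Lemma mcount0 A : mcount (fun B => B \subset A) 0 = 1.
Proof.
rewrite mcountE (big_pred1 bm0) => [|m]; first by rewrite /= msup0 sub0set.
by rewrite /= mdeg_eq0.
Qed.

Lemma mcount_set0 j : mcount (fun B => B \subset set0) j.+1 = 0.
Proof.
rewrite mcountE big1 // => m /eqP mj; rewrite subset0.
case: eqP => // /setP m0; have : mdeg m = 0%N.
  rewrite mdegE big1 // => i _; have := m0 i; rewrite !inE; lia.
by rewrite mj.
Qed.

(** Monomials divisible by X_a are X_a times a monomial of degree j; the others are supported in
    [A :\ a]. *)
Lemma mcountS A a j : a \in A ->
  mcount (fun B => B \subset A) j.+1 =
  mcount (fun B => B \subset A) j + mcount (fun B => B \subset A :\ a) j.+1.
Proof.
move=> aA; rewrite /mcount -PoszD; congr Posz.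
set P := [pred m : 'X_{1..n < j.+2} | _].
rewrite -(cardID [pred m : 'X_{1..n < j.+2} | (m : 'X_{1..n}) a != 0%N] P).
congr (_ + _)%N; last first.
  apply: eq_card => m; rewrite !inE negbK subsetD1 inE negbK.
  by rewrite [RHS]andbA andbC.
have sP (m : 'X_{1..n < j.+1}) : (mdeg (m + U_(a))%MM < j.+2)%N.
  by rewrite mdegD mdeg1 addn1 ltnS bmdeg.
rewrite -(card_image (f := fun m : 'X_{1..n < j.+1} => BMultinom (sP m))); last first.
  by move=> m m' /(congr1 (@bmnm _ _)) /= /addIm mm'; apply: val_inj.
apply: eq_card => m; rewrite !inE; apply/andP/imageP => [[/andP[mj mA] ma]|[m' + ->]].
  have mE : (m - U_(a) + U_(a))%MM = m by rewrite submK // lep1mP.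
  have md : mdeg (m - U_(a))%MM = j.
    by have := congr1 (@mdeg n) mE; rewrite mdegD mdeg1 (eqP mj) addn1 => -[].
  have lt : (mdeg (m - U_(a))%MM < j.+1)%N by rewrite md.
  exists (BMultinom lt); last by apply: val_inj; rewrite /= mE.
  rewrite inE /= md eqxx /=; apply: subset_trans mA.
  by rewrite -{2}mE msupD subsetUl.
rewrite inE /= => /andP[/eqP mj mA].
rewrite mdegD mdeg1 mj addn1 eqxx msupD msup1 subUset mA sub1set aA.
by rewrite mnmDE mnm1E eqxx addn1.
Qed.

Lemma mcount_subset A j : mcount (fun B => B \subset A) j = inv_one_minus_t_pow #|A| j.
Proof.
move: {2}#|A| (erefl #|A|) => c; elim: c A j => [|c IHc] A j cA.
  move/eqP: (cA); rewrite cards_eq0 => /eqP ->; rewrite cards0 inv_one_minus_t_pow0.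
  by case: j => [|j]; [rewrite mcount0 | rewrite mcount_set0].
have [a aA] : exists a, a \in A by apply/card_gt0P; rewrite cA.
have cD : #|A :\ a| = c by have := cardsD1 a A; rewrite aA cA; lia.
elim: j => [|j IHj]; first by rewrite mcount0 inv_one_minus_t_pow_coef0.
by rewrite (mcountS _ aA) IHj IHc // cD cA inv_one_minus_t_powS.
Qed.

(** Inclusion-exclusion for one set B. Summed over supports of monomials it gives the Hilbert
    series, over singletons the number of vertices, and at the empty set the value 1. *)
Lemma covered_facets (A sg : nat -> {set 'I_n}) k B : tree_data A sg k ->
  (covered (facets A k) B)%:R =
  \sum_(i < k) (B \subset A i)%:R - \sum_(i < k | (0 < i)%N) (B \subset sg i)%:R :> int.
Proof.
move=> tA; suff H l : (l <= k)%N -> (covered (facets A l) B)%:R =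
    \sum_(i < l) (B \subset A i)%:R
    - \sum_(i < l) (if (0 < i)%N then (B \subset sg i)%:R else 0) :> int.
  by rewrite H // -big_mkcond.
elim: l => [|l IHl] lk.
  by rewrite !big_ord0; case: coveredP => // -[].
rewrite !big_ord_recr /= coveredU covered1.
have -> : (\sum_(i < l) (B \subset A i)%:R : int) = (covered (facets A l) B)%:R +
    \sum_(i < l) (if (0 < i)%N then (B \subset sg i)%:R else 0).
  by rewrite IHl ?subrK // ltnW.
case: posnP => [->|l0].
  have -> : covered (facets A 0) B = false by apply/coveredP => -[].
  by rewrite !big_ord0; case: (B \subset _).
rewrite (tree_data_glue _ tA) ?l0 //.
by case: (B \subset A l); case: (covered _ _) => /=; ring.
Qed.

End MonomialCount.

Section HilbertFunction.
Variables (K : fieldType) (n : nat) (F : simplicial_complex n).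
Local Notation S := {mpoly K[n]}.
Local Notation proj := (@SR_proj K n F).

(** The monomials of degree j whose support is a face form a basis of the component. *)
Lemma SR_Hilbert j : exists2 h : nat,
  has_Kdim (@SR_component K n F j) h & mcount (fun A => A \in faces F) j = h%:Z.
Proof.
pose T := [pred m : 'X_{1..n < j.+1} | (mdeg m == j) && (msup m \in faces F)].
exists #|T| => //; pose e (i : 'I_#|T|) : 'X_{1..n} := enum_val i.
have eP i : (mdeg (e i) == j) && (msup (e i) \in faces F).
  by have := enum_valP i; rewrite inE.
have eI : injective e by move=> i i' /val_inj; apply: enum_val_inj.
have sumE (c : 'I_#|T| -> K) :
    \sum_(i < #|T|) (c i)%:MP *: proj 'X_[e i] = proj (\sum_i c i *: 'X_[e i]).
  by rewrite rmorph_sum; apply: eq_bigr => i _; rewrite SR_proj_scale mul_mpolyC.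
have coefE (c : 'I_#|T| -> K) i : (\sum_i c i *: 'X_[e i])@_(e i) = c i.
  rewrite raddf_sum (bigD1 i) //= mcoeffZ mcoeffX eqxx mulr1 big1 ?addr0 // => i' i'i.
  by rewrite mcoeffZ mcoeffX (inj_eq eI) (negPf i'i) mulr0.
exists (fun i => proj 'X_[e i]); split.
- move=> i; exists 'X_[e i] => //.
  by rewrite dhomogX; have /andP[] := eP i.
- move=> x [p pj ->]; exists (fun i => p@_(e i)); rewrite sumE; apply/SR_proj_eq => m.
  rewrite covered_faces mcoeffB => mF; apply/eqP; rewrite subr_eq0; apply/eqP.
  have [mj|mj] := eqVneq (mdeg m) j.
    have lt : (mdeg m < j.+1)%N by rewrite mj.
    have mT : BMultinom lt \in T by rewrite inE /= mj eqxx.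
    by have := coefE (fun i => p@_(e i)) (enum_rank_in mT (BMultinom lt));
       rewrite /e enum_rankK_in //=.
  rewrite (dhomog_nemf_coeff pj) // raddf_sum big1 //= => i _.
  rewrite mcoeffZ mcoeffX; case: eqP => [E|]; last by rewrite mulr0.
  by have /andP[/eqP ej _] := eP i; rewrite -E ej eqxx in mj.
- move=> c; rewrite sumE => /SR_proj_eq0 cI i; rewrite -[LHS]coefE; apply: cI.
  by rewrite covered_faces; have /andP[] := eP i.
Qed.

End HilbertFunction.
(** * Fat trees *)

Lemma simplex_of_dim_card n (D : {set {set 'I_n}}) (c : nat) :
  simplex_of_dim D c%:Z -> exists2 A, D = powerset A & #|A| = c.+1.
Proof. by case=> A -> cE; exists A => //; lia. Qed.

Lemma fat_tree_data n k (Fs : 'I_k -> {set {set 'I_n}}) (d r : 'I_k -> nat) :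
  (forall i, simplex_of_dim (Fs i) (d i)%:Z) ->
  (forall j : 'I_k, (0 < j)%N -> simplex_of_dim (before Fs j :&: Fs j) (r j)%:Z) ->
  exists A sg : nat -> {set 'I_n},
    [/\ tree_data A sg k, forall i : 'I_k, Fs i = powerset (A i),
        forall i : 'I_k, #|A i| = (d i).+1 &
        forall j : 'I_k, (0 < j)%N -> #|sg j| = (r j).+1].
Proof.
move=> dim_d dim_r.
have /choice [a aP] i : exists a, Fs i = powerset a /\ #|a| = (d i).+1.
  by have [a] := simplex_of_dim_card (dim_d i); exists a.
have /choice [s sP] (j : 'I_k) : exists s, (0 < j)%N ->
    before Fs j :&: Fs j = powerset s /\ #|s| = (r j).+1.
  case: (posnP j) => j0; first by exists set0.
  by have [s] := simplex_of_dim_card (dim_r j j0); exists s.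
have valE (f : 'I_k -> {set 'I_n}) (i : 'I_k) : oapp f set0 (insub (val i)) = f i.
  by rewrite valK.
exists (fun i => oapp a set0 (insub i)), (fun i => oapp s set0 (insub i)).
split; last 3 first.
- by move=> i; rewrite valE; have [] := aP i.
- by move=> i; rewrite valE; have [] := aP i.
- by move=> j j0; rewrite valE; have [] := sP j j0.
move=> j /andP[j0 jk]; pose oj := Ordinal jk.
rewrite -[j]/(val oj) !valE.
have [sE _] := sP oj j0; have [aE _] := aP oj.
(* The vertex set of the intersection is itself a face of the union of the earlier simplices, hence
   of one of them. *)
have : s oj \in before Fs oj :&: Fs oj by rewrite sE powersetE.
rewrite inE aE powersetE => /andP[/bigcupP[i ij]].
have [-> _] := aP i; rewrite powersetE => si sj.
split=> //; first by exists i; rewrite ?valE.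
move=> l lj; have lk : (l < k)%N by apply: ltn_trans lj jk.
rewrite -[l]/(val (Ordinal lk)) valE -powersetE -sE inE aE powersetE subsetIr andbT.
apply/bigcupP; exists (Ordinal lk) => //.
by have [-> _] := aP (Ordinal lk); rewrite powersetE subsetIl.
Qed.

Theorem theorem1 (K : fieldType) (n k : nat)
    (F : simplicial_complex n) (Fs : 'I_k -> {set {set 'I_n}})
    (d r : 'I_k -> nat)
    (F_union : faces F = \bigcup_(i < k) Fs i)
    (F_tree : fat_tree Fs)
    (dim_d : forall i, simplex_of_dim (Fs i) (d i)%:Z)
    (dim_r : forall j : 'I_k, (0 < j)%N ->
       simplex_of_dim (before Fs j :&: Fs j) (r j)%:Z) :
  is_Hilbert_series K F (fun j : nat =>
    \sum_(i < k) inv_one_minus_t_pow (d i).+1 j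
    - \sum_(i < k | (0 < i)%N) inv_one_minus_t_pow (r i).+1 j) /\
  (irredundant Fs ->
   [/\ (1 < k)%N -> exists2 p : nat, SR_projdim K F p &
         p%:Z = \sum_(i < k) (d i)%:Z - \sum_(i < k | (0 < i)%N) (r i)%:Z
                + 1 - (min_tail r)%:Z - 2,
       (1 < k)%N -> SR_depth K F (min_tail r + 2)%N
     & SR_CohenMacaulay K F <->
         exists e : int, (forall i, (d i)%:Z = e) /\
                         (forall i : 'I_k, (0 < i)%N -> (r i)%:Z = e - 1)]).
Proof.
have k0 : (0 < k)%N by case: F_tree => -[].
have [A [sg [tA AE Ad sgr]]] := fat_tree_data dim_d dim_r.
have facesE B : covered (facets A k) B = (B \in faces F).
  rewrite F_union; apply/coveredP/bigcupP => [[i ik BA]|[i _]].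
    by exists (Ordinal ik) => //; rewrite AE powersetE.
  by rewrite AE powersetE; exists i.
have IFE : face_ideal K (faces F) = face_ideal K (facets A k).
  by apply: submod_ext => p; split=> pI m mF; apply: pI;
     move: mF; rewrite facesE covered_faces.
have FE B : ((B \in faces F)%:R : int) = \sum_(i < k) (B \subset A i)%:R
    - \sum_(i < k | (0 < i)%N) (B \subset sg i)%:R.
  by rewrite -facesE (covered_facets _ tA).
split=> [j|irr].
  have [h hP hE] := SR_Hilbert K F j; exists h => //.
  rewrite -hE mcountE; under [RHS]eq_bigr do rewrite FE.
  rewrite sumrB exchange_big /= [X in _ = _ - X]exchange_big /=.
  congr (_ - _); apply: eq_bigr => i i0.
    by rewrite -Ad -mcount_subset mcountE.
  by rewrite -sgr // -mcount_subset mcountE.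
have irrA i j : (i < k)%N -> (j < k)%N -> A i \subset A j -> i = j.
  move=> ik jk Aij; have [] : Ordinal ik = Ordinal jk by apply: irr; rewrite !AE powersetS.
  by [].
have An i : (#|A i| <= n)%N by rewrite -[X in (_ <= X)%N]card_ord max_card.
(* If s_j had as many vertices as A_j, then A_j would lie in an earlier facet. *)
have rd (j : 'I_k) : (0 < j)%N -> (r j < d j)%N.
  move=> j0; have jk : (0 < j < k)%N by rewrite j0 ltn_ord.
  have [[i ij si] sj _] := tA j jk.
  rewrite -ltnS -Ad -sgr // ltnNge; apply/negP => As.
  have E : sg j = A j by apply/eqP; rewrite eqEcard sj.
  by rewrite E in si; have := irrA j i (ltn_ord j) (ltn_trans ij (ltn_ord j)) si; lia.
have coverE v : [set v] \in faces F by apply: face1.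
pose o0 := Ordinal k0.
(* A single simplex has no r_j. Then K[F] is the polynomial ring, of dimension and depth d_0 + 1 =
   n. *)
have [k1|k1] := leqP k 1.
  have i0 (i : 'I_k) : i = o0 by apply: val_inj; rewrite /=; have := ltn_ord i; lia.
  have A0 : A 0%N = setT.
    apply/setP => v; rewrite inE; have := coverE v; rewrite -facesE => /coveredP[i ik].
    by rewrite sub1set (_ : i = 0%N) //; lia.
  have dn : (d o0).+1 = n by rewrite -Ad /= A0 cardsT card_ord.
  split=> //; split=> _.
    exists (d o0)%:Z; split=> i; first by rewrite (i0 i).
    by have := ltn_ord i; lia.
  exists (d o0).+1.
    split.
      rewrite -Ad; apply: SR_prime_chain.
      by rewrite -facesE; apply/coveredP; exists 0%N.
    by move=> c /prime_chain_face[B _ cB]; rewrite dn; apply: leq_trans cB _;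
       rewrite -[X in (_ <= X)%N]card_ord max_card.
  apply: SR_depth_wregular; rewrite IFE.
    apply: (wregular_tree K tA) => // [i ik|j]; last by lia.
    by rewrite (_ : i = o0) ?Ad //=; lia.
  exists 0%N; split=> //; apply: koszul_nonzero0.
  by apply/coveredP; exists 0%N; rewrite ?sub0set.
have [[j0 j00 mE] mle] := min_tailP r k1; set m := min_tail r in mE mle *.
pose o1 := Ordinal k1.
(* The first simplex has no r of its own; s_1, which lies in A_0, provides m < d_0. *)
have r1d0 : (r o1 < d o0)%N.
  rewrite -ltnS -Ad -sgr // ltnNge; apply/negP => As.
  have [[i i1 si] sj _] := tA 1%N k1; rewrite (_ : i = 0%N) in si; last by lia.
  have E : sg 1%N = A 0%N by apply/eqP; rewrite eqEcard si.
  by rewrite E in sj; have := irrA 0%N 1%N k0 k1 sj.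
have md (i : 'I_k) : (m < d i)%N.
  have [i0|i0] := posnP i; last by apply: leq_ltn_trans (rd i i0); apply: mle.
  by rewrite (_ : i = o0) //; [apply: leq_ltn_trans r1d0; apply: mle | apply: val_inj].
have eA i : (i < k)%N -> (m + 2 <= #|A i|)%N.
  by move=> ik; rewrite -[i]/(val (Ordinal ik)) Ad; have := md (Ordinal ik); lia.
have esg j : (0 < j < k)%N -> (m + 2 <= #|sg j|.+1)%N.
  move=> /andP[j0' jk]; rewrite -[j]/(val (Ordinal jk)) sgr //.
  by have := mle (Ordinal jk) j0'; lia.
(* Strictness makes n - (m + 2) a successor, the form in which [SR_projdim_koszul] takes the
   projective dimension. *)
have en : (m + 2 < n)%N.
  apply: leq_ltn_trans (eA 0%N k0) _; rewrite ltn_neqAle An andbT.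
  apply/eqP => A0n; have := irrA 1%N 0%N k1 k0; rewrite (_ : A 0%N = setT) ?subsetT.
    by move/(_ isT).
  by apply/eqP; rewrite eqEcard subsetT cardsT card_ord A0n leqnn.
have kz : koszul_nonzero (fun i => 'X_i : {mpoly K[n]}) (face_ideal K (faces F)) (n - (m + 2)).
  have jk : (0 < j0 < k)%N by rewrite j00 ltn_ord.
  have [U [a [b [UW aU bW sep]]]] := tree_separation tA irrA jk.
  (* The chosen s_j has m + 1 vertices, its complement n - m - 1, and the class lives one degree
     lower. *)
  rewrite IFE (_ : (n - (m + 2))%N = #|~: sg j0|.-1).
    by apply: (koszul_nonzero_separated K _ UW aU bW sep) => v; rewrite facesE.
  by rewrite cardsCs setCK card_ord sgr // -mE; lia.
have depthF : SR_depth K F (m + 2).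
  apply: SR_depth_wregular; first by rewrite IFE; apply: (wregular_tree K tA eA esg k0).
  by exists (n - (m + 2))%N; rewrite subnK // ltnW.
split=> [_|//|].
  exists (n - (m + 2))%N.
    have nE : (n - (m + 2))%N = (n - (m + 2)).-1.+1 by lia.
    rewrite nE; apply: SR_projdim_koszul; last by rewrite -nE.
    by apply: pdle_SR_ring; rewrite IFE; apply: (pdle_tree K tA eA esg) => //; lia.
  have cardE (B : {set 'I_n}) : #|B|%:Z = \sum_v ([set v] \subset B)%:R.
    rewrite -sum1_card -natz natr_sum big_mkcond; apply: eq_bigr => v _.
    by rewrite sub1set; case: (v \in B).
  have nE : n%:Z = \sum_(i < k) (d i).+1%:Z - \sum_(i < k | (0 < i)%N) (r i).+1%:Z.
    have := cardE setT; rewrite cardsT card_ord => ->.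
    transitivity (\sum_v ([set v] \in faces F)%:R : int).
      by apply: eq_bigr => v _; rewrite subsetT coverE.
    under eq_bigr do rewrite FE.
    rewrite sumrB exchange_big /= [X in _ - X]exchange_big /=.
    by congr (_ - _); apply: eq_bigr => i i0; rewrite -cardE ?Ad ?sgr.
  (* At the empty face inclusion-exclusion reads 1 = k - (k - 1), which converts the sums of d_i + 1
     and r_i + 1 into those of d_i and r_i. *)
  have oneE : (1 : int) = \sum_(i < k) 1 - \sum_(i < k | (0 < i)%N) 1.
    transitivity ((set0 \in faces F)%:R : int); first by rewrite face0.
    by rewrite FE; congr (_ - _); apply: eq_bigr => i _; rewrite sub0set.
  have dE : \sum_(i < k) (d i).+1%:Z = \sum_(i < k) (d i)%:Z + \sum_(i < k) 1.
    by rewrite -big_split; apply: eq_bigr => i _ /=; lia.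
  have rE : \sum_(i < k | (0 < i)%N) (r i).+1%:Z =
      \sum_(i < k | (0 < i)%N) (r i)%:Z + \sum_(i < k | (0 < i)%N) 1.
    by rewrite -big_split; apply: eq_bigr => i _ /=; lia.
  rewrite dE rE in nE; have -> : (n - (m + 2))%:Z = n%:Z - m%:Z - 2 by lia.
  have arith (x y u v t : int) : 1 = u - v ->
    x + u - (y + v) - t - 2 = x - y + 1 - t - 2 by lia.
  by rewrite nE; apply: arith.
split=> [[c [_ cmax] cdepth]|[e [de re]]].
  have cE : c = (m + 2)%N := SR_depth_unique cdepth depthF.
  (* F_i gives a prime chain of length d_i + 1, so d_i + 1 <= m + 2, while m < d_i. *)
  have dm (i : 'I_k) : d i = m.+1.
    have := md i; have : prime_chain (SR_ring K F) (d i).+1.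
      by rewrite -Ad; apply: SR_prime_chain; rewrite -facesE; apply/coveredP; exists i.
    by move/cmax; rewrite cE; lia.
  exists m.+1%:Z; split=> [i|i i0]; first by rewrite dm.
  by have := mle i i0; have := rd i i0; rewrite dm; lia.
exists (m + 2)%N => //.
have dm (i : 'I_k) : (d i).+1 = (m + 2)%N by have := re j0 j00; have := de i; rewrite -mE; lia.
split.
  rewrite -(dm o0) -Ad; apply: SR_prime_chain.
  by rewrite -facesE; apply/coveredP; exists 0%N.
move=> c /prime_chain_face[B]; rewrite -facesE => /coveredP[i ik BA] cB.
apply: leq_trans cB _; rewrite -(dm (Ordinal ik)) -Ad.
exact: subset_leq_card.
Qed.
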